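(* Let $\Bbbk$ be a field of characteristic $p>0$ and let $U$ be the Hopf algebra over $\Bbbk$ defined in the context. Let $U$ act inner-faithfully and homogeneously on a noetherian Koszul Artin-Schelter regular $\Bbbk$-algebra $T$ of global dimension $2$. (1) $T$ is commutative, namely, $T=\Bbbk[V]$ where $V=T_1$. As a consequence, $V$ is a $2$-dimensional indecomposable left $U$-module. (2) Write $V$ as $M(2,i)=\Bbbk x_1\oplus\Bbbk x_2$ for some $0\leq i\leq p-1$, where $x_1,x_2$ is a standard basis. Then the following hold. (2a) If $V=M(2,p-1)$, then $T^U=\Bbbk[x_1^p,x_2]$. (2b) If $V=M(2,i)$ for some $0\leq i\leq p-2$, then $T^U=\Bbbk[x_1^p,x_2^p]$.
   Context: $U$ is the $\Bbbk$-algebra generated by $u$ and $w$ subject to $u^p=0$, $w^p=w$, $wu-uw=u$. It is a Hopf algebra of dimension $p^2$ with $u$ and $w$ primitive: $\Delta(u)=u\otimes 1+1\otimes u$, $\Delta(w)=w\otimes 1+1\otimes w$, $\varepsilon(u)=\varepsilon(w)=0$, $S(u)=-u$, $S(w)=-w$. $\mathbb{Z}_p=\mathbb{Z}/(p)$ is regarded as the prime subfield of $\Bbbk$. For $1\leq l\leq p$ and $i\in\mathbb{Z}_p$, $M(l,i)$ is the left $U$-module with $\Bbbk$-basis $x_1,\dots,x_l$ (called a standard basis) and action $w\cdot x_j=(i+j-1)x_j$ for $1\leq j\leq l$, $u\cdot x_j=x_{j+1}$ for $1\leq j\leq l-1$, $u\cdot x_l=0$. A connected graded $\Bbbk$-algebra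 $T=\bigoplus_{n\geq 0}T_n$ ($T_0=\Bbbk$) is Artin-Schelter (AS) regular of dimension $d$ if: (a) $T$ has global dimension $d<\infty$; (b) $\mathrm{Ext}^i_T({}_T\Bbbk,{}_TT)=\mathrm{Ext}^i_T(\Bbbk_T,T_T)=0$ for all $i\neq d$, where $\Bbbk=T/T_{\geq 1}$; (c) $\mathrm{Ext}^d_T({}_T\Bbbk,{}_TT)\cong\mathrm{Ext}^d_T(\Bbbk_T,T_T)\cong\Bbbk(l)$ (a degree shift of $\Bbbk$) for some integer $l$; (d) $T$ has finite Gelfand-Kirillov dimension. An action of a Hopf algebra $H$ on an algebra $T$ means that $T$ is a left $H$-module algebra. It is inner-faithful if there is no nonzero Hopf ideal $I\subseteq H$ with $IT=0$, and homogeneous if each graded piece $T_n$ is a left $H$-submodule of $T$. The fixed subring is $T^H=\{a\in T\mid h\cdot a=\varepsilon(h)a\ \forall h\in H\}$. *)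

(* Defs.v *)
From HB Require Import structures.
From mathcomp Require Import all_boot all_order all_algebra.
From mathcomp Require Import mpoly.

Set Implicit Arguments.
Unset Strict Implicit.
Unset Printing Implicit Defensive.

Import GRing.Theory.
Local Open Scope ring_scope.

(* Subspaces, ideals and graded pieces are Prop-valued predicates.  A left
   module over R is an [lmodType R]; a right R-module is a left module over
   the converse ring, i.e. an [lmodType R^c], with  x . t  written  t *: x.   *)

Section Tensor.
Variables (k : fieldType) (H : lmodType k).

Definition bilinear_map (W : lmodType k) (f : H -> H -> W) : Prop :=
  (forall x, linear (f x)) /\ (forall y, linear (f^~ y)).

Definition trilinear_map (W : lmodType k) (f : H -> H -> H -> W) : Prop :=
  [/\ forall x y, linear (f x y), forall x z, linear (fun y => f x y z)
    & forall y z, linear (fun x => f x y z)].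

(* A list [:: (a1, b1); ...; (an, bn)] stands for the tensor
   a1 (x) b1 + ... + an (x) bn  of  H (x) H.  By the universal property of the
   tensor product two lists are the same tensor iff no bilinear map separates
   them.                                                                      *)
Definition tensor_eq (s t : seq (H * H)) : Prop :=
  forall (W : lmodType k) (f : H -> H -> W), bilinear_map f ->
    \sum_(x <- s) f x.1 x.2 = \sum_(x <- t) f x.1 x.2.

End Tensor.

(* The comultiplication is given by representatives: comul h is a Sweedler
   expression  [:: (h_1, h_2); ...]  of  Delta(h).                            *)
Record hopfAlgebra (k : fieldType) := HopfAlgebra {
  hopf_alg :> algType k;
  comul : hopf_alg -> seq (hopf_alg * hopf_alg);
  counit : hopf_alg -> k;
  antipode : hopf_alg -> hopf_alg;
  comul_linear : forall (c : k) (a b : hopf_alg),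
    tensor_eq (comul (c *: a + b))
              ([seq (c *: x.1, x.2) | x <- comul a] ++ comul b);
  comul_one : tensor_eq (comul 1) [:: (1, 1)];
  comul_mul : forall a b : hopf_alg,
    tensor_eq (comul (a * b))
              [seq (x.1 * y.1, x.2 * y.2) | x <- comul a, y <- comul b];
  counit_linear : forall (c : k) (a b : hopf_alg),
    counit (c *: a + b) = c * counit a + counit b;
  counit_one : counit 1 = 1;
  counit_mul : forall a b : hopf_alg, counit (a * b) = counit a * counit b;
  comul_coassoc : forall (a : hopf_alg) (W : lmodType k)
      (f : hopf_alg -> hopf_alg -> hopf_alg -> W), trilinear_map f ->
    \sum_(x <- comul a) \sum_(y <- comul x.1) f y.1 y.2 x.2 =
    \sum_(x <- comul a) \sum_(y <- comul x.2) f x.1 y.1 y.2;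
  counit_left : forall a : hopf_alg,
    \sum_(x <- comul a) counit x.1 *: x.2 = a;
  counit_right : forall a : hopf_alg,
    \sum_(x <- comul a) counit x.2 *: x.1 = a;
  antipode_linear : forall (c : k) (a b : hopf_alg),
    antipode (c *: a + b) = c *: antipode a + antipode b;
  antipode_left : forall a : hopf_alg,
    \sum_(x <- comul a) antipode x.1 * x.2 = (counit a)%:A;
  antipode_right : forall a : hopf_alg,
    \sum_(x <- comul a) x.1 * antipode x.2 = (counit a)%:A
}.

Definition subspace (k : fieldType) (M : lmodType k) (S : M -> Prop) : Prop :=
  S 0 /\ forall (c : k) x y, S x -> S y -> S (c *: x + y).

(* Membership of Delta(x) in  I (x) H + H (x) I  is the existence of a
   representative all of whose terms have a component in I.                   *)
Definition hopf_ideal (k : fieldType) (H : hopfAlgebra k) (I : H -> Prop) :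
    Prop :=
  [/\ subspace I,
      forall a x b, I x -> I (a * x * b),
      forall x, I x -> exists2 s : seq (H * H), tensor_eq (comul x) s &
        forall y, y \in s -> I y.1 \/ I y.2,
      forall x, I x -> counit x = 0
    & forall x, I x -> I (antipode x)].

Section Actions.
Variables (k : fieldType) (H : hopfAlgebra k) (T : algType k).
Variable act : H -> T -> T.

Definition hopf_module : Prop :=
  [/\ forall h, linear (act h),
      forall x (c : k) g h, act (c *: g + h) x = c *: act g x + act h x,
      forall x, act 1 x = x
    & forall g h x, act (g * h) x = act g (act h x)].

Definition hopf_action : Prop :=
  [/\ hopf_module,
      forall h a b, act h (a * b) = \sum_(x <- comul h) act x.1 a * act x.2 b
    & forall h, act h 1 = (counit h)%:A].

Definition inner_faithful : Prop :=
  ~ exists I : H -> Prop,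
      [/\ hopf_ideal I, exists2 h, I h & h != 0
        & forall h a, I h -> act h a = 0].

Definition submodule (V : T -> Prop) : Prop :=
  subspace V /\ forall h x, V x -> V (act h x).

Definition homogeneous_action (G : nat -> T -> Prop) : Prop :=
  forall n, submodule (G n).

Definition indecomposable (V : T -> Prop) : Prop :=
  [/\ submodule V, exists2 x, V x & x != 0 &
      forall A B : T -> Prop, submodule A -> submodule B ->
        (forall x, V x <-> exists a b, [/\ A a, B b & x = a + b]) ->
        (forall x, A x -> B x -> x = 0) ->
        (forall x, A x -> x = 0) \/ (forall x, B x -> x = 0)].

Definition fixed (a : T) : Prop := forall h, act h a = counit h *: a.

End Actions.

Definition U_relations (k : fieldType) (p : nat) (A : algType k) (u w : A) :
    Prop :=
  [/\ u ^+ p = 0, w ^+ p = w & w * u - u * w = u].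

Definition primitive (k : fieldType) (H : hopfAlgebra k) (h : H) : Prop :=
  [/\ tensor_eq (comul h) [:: (h, 1); (1, h)], counit h = 0
    & antipode h = - h].

(* "Generated by u and w subject to the relations": the universal property of
   the presentation, which determines (U, u, w) up to unique isomorphism.     *)
Definition is_U (k : fieldType) (p : nat) (U : hopfAlgebra k) (u w : U) : Prop :=
  [/\ U_relations p u w,
      forall (A : algType k) (a b : A), U_relations p a b ->
        exists f : {lrmorphism U -> A}, [/\ f u = a, f w = b
          & forall g : {lrmorphism U -> A}, g u = a -> g w = b -> g =1 f],
      primitive u
    & primitive w].

Definition basis_of (k : fieldType) (M : lmodType k) (V : M -> Prop) (n : nat)
    (x : 'I_n -> M) : Prop :=
  (forall c : 'I_n -> k, \sum_j c j *: x j = 0 -> forall j, c j = 0) /\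
  (forall v, V v <-> exists c : 'I_n -> k, v = \sum_j c j *: x j).

Definition has_dim (k : fieldType) (M : lmodType k) (V : M -> Prop) (n : nat) :
  Prop := exists x : 'I_n -> M, basis_of V x.

(* x is a standard basis of V, exhibiting V as M(l,i); the index j : 'I_l
   starts at 0, so that w acts on x j by i + j.                        *)
Definition standard_basis (k : fieldType) (U : hopfAlgebra k) (u w : U)
    (T : algType k) (act : U -> T -> T) (V : T -> Prop) (l i : nat)
    (x : 'I_l -> T) : Prop :=
  [/\ basis_of V x,
      forall j : 'I_l, act w (x j) = (i + j)%:R *: x j,
      forall j j' : 'I_l, j' = j.+1 :> nat -> act u (x j) = x j'
    & forall j : 'I_l, j.+1 = l -> act u (x j) = 0].

Definition add_subgroup (M : zmodType) (S : M -> Prop) : Prop :=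
  S 0 /\ forall x y, S x -> S y -> S (x - y).

Definition direct_sum (I : eqType) (M : zmodType) (S : I -> M -> Prop) : Prop :=
  [/\ forall i, add_subgroup (S i),
      forall x, exists (s : seq I) (f : I -> M),
        (forall i, S i (f i)) /\ x = \sum_(i <- s) f i
    & forall (s : seq I) (f : I -> M), uniq s -> (forall i, S i (f i)) ->
        \sum_(i <- s) f i = 0 -> forall i, i \in s -> f i = 0].

Definition connected_graded (k : fieldType) (T : algType k)
    (G : nat -> T -> Prop) : Prop :=
  [/\ forall n, subspace (G n),
      direct_sum G,
      forall m n a b, G m a -> G n b -> G (m + n)%N (a * b)
    & forall a, G 0%N a <-> exists c : k, a = c%:A].

Section Homological.
Variable R : nzRingType.

Definition surjective (A B : Type) (f : A -> B) : Prop :=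
  forall y, exists x, f x = y.

Definition projective (P : lmodType R) : Prop :=
  forall (M N : lmodType R) (g : {linear M -> N}) (f : {linear P -> N}),
    surjective g -> exists h : {linear P -> M}, forall x, g (h x) = f x.

Record chain := Chain {
  term :> nat -> lmodType R;
  diff : forall n, {linear term n.+1 -> term n}
}.

Definition resolution (P : chain) (M : lmodType R) (e : {linear P 0%N -> M}) :
    Prop :=
  [/\ surjective e,
      forall x, e x = 0 <-> exists y, diff P 0 y = x
    & forall n x, diff P n x = 0 <-> exists y, diff P n.+1 y = x].

Definition projdim_le (M : lmodType R) (d : nat) : Prop :=
  exists (P : chain) (e : {linear P 0%N -> M}),
    [/\ resolution e, forall n, projective (P n)
      & forall n, (d < n)%N -> forall x : P n, x = 0].

Definition gldim_le (d : nat) : Prop :=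
  forall M : lmodType R, projdim_le M d.

Definition gldim (d : nat) : Prop :=
  gldim_le d /\ forall m, gldim_le m -> (d <= m)%N.

Definition left_ideal (I : R -> Prop) : Prop :=
  add_subgroup I /\ forall a x, I x -> I (a * x).

Definition left_noetherian : Prop :=
  forall I : R -> Prop, left_ideal I -> exists (n : nat) (x : 'I_n -> R),
    forall a, I a <-> exists c : 'I_n -> R, a = \sum_j c j * x j.

Section Graded.
Variable G : nat -> R -> Prop.

Definition int_graded (j : int) (a : R) : Prop :=
  match j with Posz n => G n a | Negz _ => a = 0 end.

Definition positive_part (a : R) : Prop :=
  exists (s : seq nat) (f : nat -> R),
    (forall i, i \in s -> (0 < i)%N /\ G i (f i)) /\ a = \sum_(i <- s) f i.

(* K is (isomorphic to)  R / R_{>=1}  as a left R-module. *)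
Definition residue_module (K : lmodType R) : Prop :=
  exists pi : {linear R^o -> K},
    surjective pi /\ forall a : R, pi a = 0 <-> positive_part a.

Definition residue_grading (K : lmodType R) (j : int) (y : K) : Prop :=
  j = 0 \/ y = 0.

Definition graded_module (M : lmodType R) (Mg : int -> M -> Prop) : Prop :=
  direct_sum Mg /\
  forall n j a x, G n a -> Mg j x -> Mg (n%:Z + j) (a *: x).

Definition graded_resolution (K : lmodType R) (P : chain)
    (Pg : forall n, int -> P n -> Prop) (e : {linear P 0%N -> K}) : Prop :=
  [/\ resolution e,
      forall n, graded_module (Pg n),
      forall n j x, Pg n.+1 j x -> Pg n j (diff P n x)
    & forall j x, Pg 0%N j x -> residue_grading j (e x)].

Definition graded_projective_resolution (K : lmodType R) (P : chain)
    (Pg : forall n, int -> P n -> Prop) (e : {linear P 0%N -> K}) : Prop :=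
  graded_resolution Pg e /\ forall n, projective (P n).

Definition basis_in_degree (M : lmodType R) (Mg : int -> M -> Prop) (j : int) :
    Prop :=
  exists (I : eqType) (b : I -> M),
    [/\ forall i, Mg j (b i),
        forall x, exists (s : seq I) (c : I -> R), x = \sum_(i <- s) c i *: b i
      & forall (s : seq I) (c : I -> R), uniq s ->
          \sum_(i <- s) c i *: b i = 0 -> forall i, i \in s -> c i = 0].

(* The trivial module has a linear free resolution. *)
Definition koszul : Prop :=
  exists (K : lmodType R) (P : chain) (Pg : forall n, int -> P n -> Prop)
         (e : {linear P 0%N -> K}),
    [/\ residue_module K, graded_resolution Pg e
      & forall n, basis_in_degree (Pg n) n%:Z].

(* Ext^i_R(K, R) is computed as the cohomology of the complex of graded
   Homs  Hom_R(P, R) = (+)_j Hom_R(P, R)_j,  where P is a graded projective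
   resolution of K and the degree j part consists of the R-linear maps sending
   degree n to degree n + j.                                                  *)
Section Ext.
Variables (P : chain) (Pg : forall n, int -> P n -> Prop).

Definition cochain (i : nat) (j : int) (f : P i -> R) : Prop :=
  linear (f : P i -> R^o) /\ forall n x, Pg n x -> int_graded (n + j) (f x).

Definition cocycle (i : nat) (j : int) (f : P i -> R) : Prop :=
  cochain j f /\ forall y : P i.+1, f (diff P i y) = 0.

Definition coboundary (i : nat) (j : int) : (P i -> R) -> Prop :=
  match i return (P i -> R) -> Prop with
  | 0%N => fun f => forall x, f x = 0
  | i'.+1 => fun f => exists g : P i' -> R,
      cochain j g /\ forall x, f x = g (diff P i' x)
  end.

Definition ext_zero (i : nat) : Prop :=
  forall j (f : P i -> R), cocycle j f -> coboundary j f.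

(* phi induces an isomorphism of graded right R-modules from Ext^i(K, R) to
   the shift N(l), where N(l)_j = N_{l+j}; R acts on cocycles by
   (f . t)(x) = f(x) t.                                                       *)
Definition ext_shift_iso (i : nat) (N : lmodType R^c) (Ng : int -> N -> Prop)
    (l : int) : Prop :=
  exists phi : (P i -> R) -> N,
    [/\ forall j f, cocycle j f -> Ng (l + j) (phi f),
        forall j f g, cocycle j f -> cocycle j g ->
          phi (fun x => f x + g x) = phi f + phi g,
        forall j n f t, cocycle j f -> G n t ->
          phi (fun x => f x * t) = (t : R^c) *: phi f,
        forall j f, cocycle j f -> (phi f = 0 <-> coboundary j f)
      & forall j y, Ng (l + j) y -> exists2 f, cocycle j f & phi f = y].

End Ext.
End Graded.
End Homological.

Section ArtinSchelter.
Variable R : nzRingType.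

(* Ext^i(k, R) = 0 for i <> d  and  Ext^d(k, R) = k(l), for left R-modules. *)
Definition AS_gorenstein (G : nat -> R -> Prop) (d : nat) (l : int) : Prop :=
  forall (K : lmodType R) (P : chain R) (Pg : forall n, int -> P n -> Prop)
         (e : {linear P 0%N -> K}),
    residue_module G K -> graded_projective_resolution G Pg e ->
    (forall i, i <> d -> ext_zero G Pg i) /\
    (forall N : lmodType R^c, @residue_module R^c G N ->
       ext_shift_iso G Pg d (@residue_grading R^c N) l).

End ArtinSchelter.

(* The span of the words of length at most n in the elements of s. *)
Definition word_span (k : fieldType) (T : algType k) (s : seq T) (n : nat)
    (a : T) : Prop :=
  forall S : T -> Prop, subspace S ->
    (forall v : seq T, (size v <= n)%N -> {subset v <= s} ->
       S (\prod_(x <- v) x)) ->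
    S a.

Definition dim_le (k : fieldType) (M : lmodType k) (S : M -> Prop) (n : nat) :
    Prop :=
  exists x : 'I_n -> M, forall a, S a ->
    exists c : 'I_n -> k, a = \sum_j c j *: x j.

(* sup_V limsup_n log_n dim(V^n) < oo, where V runs over the subspaces spanned
   by 1 and a finite set s: the exponent d is uniform in s, the threshold is
   not.                                                                       *)
Definition finite_GKdim (k : fieldType) (T : algType k) : Prop :=
  exists d : nat, forall s : seq T, exists n0 : nat, forall n, (n0 <= n)%N ->
    dim_le (word_span s n) (n ^ d).

Definition AS_regular (k : fieldType) (T : algType k) (G : nat -> T -> Prop)
    (d : nat) : Prop :=
  [/\ connected_graded G,
      gldim T d /\ gldim T^c d,
      exists l : int, AS_gorenstein G d l /\ @AS_gorenstein T^c G d l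
    & finite_GKdim T].

Definition noetherian (R : nzRingType) : Prop :=
  left_noetherian R /\ left_noetherian R^c.

(* T = k[V]: a basis of V freely generates T as a commutative algebra. *)
Definition polynomial_ring_on (k : fieldType) (T : algType k)
    (V : T -> Prop) : Prop :=
  exists (n : nat) (x : 'I_n -> T) (f : {lrmorphism {mpoly k[n]} -> T}),
    [/\ basis_of V x, forall j, f 'X_j = x j & bijective f].

Definition subalgebra (k : fieldType) (T : algType k) (S : T -> Prop) : Prop :=
  [/\ subspace S, S 1 & forall a b, S a -> S b -> S (a * b)].

Definition generated_by (k : fieldType) (T : algType k) (s : seq T) (a : T) :
    Prop :=
  forall S : T -> Prop, subalgebra S -> (forall x, x \in s -> S x) -> S a.

(* Main.v *)
Require Import Defs.
From HB Require Import structures.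
From mathcomp Require Import all_boot all_order all_algebra.
From mathcomp Require Import boolp mpoly ring zify.

(** Let  V = T_1.  A Koszul algebra of global dimension 2 has a linear free
   resolution  0 -> P_2 -> P_1 -> P_0  of its trivial module: comparing it with
   any projective resolution of length 2 shows that every map from  P_3  to the
   trivial module vanishes, so that  P_3 = 0  (diff1_injective).  The Gorenstein
   condition is then used in two places.  The functions dual to a basis of  P_2
   have independent classes in  Ext^2,  which is a line, so there is exactly one
   relation; and  Ext^1 = 0  forces the coefficients  a_i  of that relation
   sum_i a_i v_i = 0  to be linearly independent, that is, the relation is a
   nondegenerate element of  V (x) V  (koszul_AS_one_relator).

   For such an algebra the syzygies of  (v_i)  are the multiples of  (a_i).  By
   induction on the degree, nonzero elements of  V  are regular.  If  dim V > 2,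
   two generators then generate a free algebra, against finite Gelfand-Kirillov
   dimension; if  dim V < 2,  the map  P_2 -> P_1  is not injective.  Hence
   dim V = 2  (relation_rank_eq2).

   The left ideal  U u  is a Hopf ideal, so inner faithfulness makes  u  act
   nontrivially on the plane  V;  since  u  is nilpotent and  w u - u w = u,
   this produces a standard basis  x_1, x_2  (exists_standard_basis).  The
   relation spans a submodule of  V (x) V.  It is killed by the nilpotent  u,
   hence is a combination of  x_1 x_2 - x_2 x_1  and  x_2^2;  these have distinct
   eigenvalues under  w,  and  x_2^2  is degenerate.  So the relation is the
   commutator (standard_relation), and the syzygies of  (x_1, x_2)  show that the
   monomials are a basis of  T  (monomial_spanning, monomial_free).

   Finally  u  acts as the derivation  x_2 d/dx_1  and  w  multiplies
   x_1^a x_2^b  by  a i + b (i + 1),  so the invariants are spanned by the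
   monomials with  p | a  and  p | b (i + 1)  (fixed_monomials). *)

Set Implicit Arguments.
Unset Strict Implicit.
Unset Printing Implicit Defensive.

Import GRing.Theory.
Local Open Scope ring_scope.

(** * Direct sums and free families *)

Lemma choice_ex (X Y : Type) (P : X -> Y -> Prop) :
  (forall x, exists y, P x y) -> exists f, forall x, P x (f x).
Proof. by move=> /choice[f]; exists f. Qed.

Lemma linear_bundle (R : nzRingType) (M N : lmodType R) (f : M -> N) :
  linear f -> exists h : {linear M -> N}, forall x, h x = f x.
Proof.
move=> lf.
pose h : {linear M -> N} := HB.pack f (GRing.isLinear.Build R M N _ f lf).
by exists h.
Qed.

Lemma eq_big_support (I : eqType) (M : zmodType) (s t : seq I) (f : I -> M) :
  uniq s -> uniq t -> {subset s <= t} -> (forall i, i \notin s -> f i = 0) ->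
  \sum_(i <- s) f i = \sum_(i <- t) f i.
Proof.
move=> us ut st f0; rewrite [RHS](bigID (mem s)) /= [X in _ + X]big1 // addr0.
rewrite -[RHS]big_filter; apply: perm_big; apply: uniq_perm => //.
  exact: filter_uniq.
by move=> i; rewrite mem_filter; case: (boolP (i \in s)) => // /st ->.
Qed.

(** The component maps of a direct sum decomposition. *)
Definition projections (I : eqType) (M : zmodType) (S : I -> M -> Prop)
    (pr : I -> M -> M) : Prop :=
  [/\ forall i x y, pr i (x - y) = pr i x - pr i y,
      forall i x, S i (pr i x),
      forall i x, S i x -> pr i x = x,
      forall i j x, S i x -> j != i -> pr j x = 0
    & forall x, exists s, [/\ uniq s, forall i, i \notin s -> pr i x = 0
                          & x = \sum_(i <- s) pr i x]].

Section DirectSum.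
Variables (I : eqType) (M : zmodType) (S : I -> M -> Prop).
Hypothesis dS : direct_sum S.

Let decomp x (f : I -> M) := (forall i, S i (f i)) /\
  exists s, [/\ uniq s, forall i, i \notin s -> f i = 0 & x = \sum_(i <- s) f i].

Let S0 i : S i 0. Proof. by case: dS => /(_ i)[]. Qed.
Let SB i x y : S i x -> S i y -> S i (x - y).
Proof. by case: dS => /(_ i)[_ h] _ _; apply: h. Qed.
Let SD i x y : S i x -> S i y -> S i (x + y).
Proof. by move=> sx sy; rewrite -[y]opprK; apply: SB => //; rewrite -sub0r; apply: SB. Qed.

Let decomp_ex x : exists f, decomp x f.
Proof.
case: dS => _ /(_ x)[s [f [Sf ->]]] _.
exists (fun i => if i \in s then f i *+ count_mem i s else 0); split.
  move=> i; case: ifP => // _; elim: (count_mem i s) => [|n IH]; rewrite ?mulr0n //.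
  by rewrite mulrS; apply: SD.
exists (undup s); split; first exact: undup_uniq.
  by move=> i; rewrite mem_undup => /negbTE ->.
rewrite -big_undup_iterop_count; apply: eq_big_seq => i; rewrite mem_undup => ->.
by [].
Qed.

Let decompB x y f g : decomp x f -> decomp y g -> decomp (x - y) (fun i => f i - g i).
Proof.
move=> [Sf [s [us fs ->]]] [Sg [t [ut gt ->]]]; split; first by move=> i; apply: SB.
exists (undup (s ++ t)); split; first exact: undup_uniq.
  move=> i; rewrite mem_undup mem_cat negb_or => /andP[/fs -> /gt ->].
  by rewrite subrr.
rewrite (eq_big_support us (undup_uniq (s ++ t))) //; last first.
  by move=> i is_; rewrite mem_undup mem_cat is_.
rewrite (eq_big_support ut (undup_uniq (s ++ t))) //; last first.
  by move=> i is_; rewrite mem_undup mem_cat is_ orbT.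
by rewrite sumrB.
Qed.

Let decomp0 f : decomp 0 f -> forall i, f i = 0.
Proof.
move=> [Sf [s [us fs e]]] i; case: (boolP (i \in s)) => [is_|/fs //].
by case: dS => _ _ /(_ s f us Sf (esym e) i is_).
Qed.

Let decomp_inj x f g : decomp x f -> decomp x g -> f =1 g.
Proof.
move=> df dg i; apply/eqP; rewrite -subr_eq0; apply/eqP.
by apply: (decomp0 (f := fun i => f i - g i)); rewrite -(subrr x); apply: decompB.
Qed.

Lemma direct_sum_proj : exists pr, projections S pr.
Proof.
have [F FP] := choice decomp_ex.
have hom i x : S i x -> decomp x (fun j => if j == i then x else 0).
  move=> Sx; split; first by move=> j; case: eqP => // ->.
  exists [:: i]; split=> //; last by rewrite big_seq1 eqxx.
  by move=> j; rewrite inE => /negbTE ->.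
exists (fun i x => F x i); split.
- by move=> i x y; apply: (decomp_inj (FP _) (decompB (FP x) (FP y))).
- by move=> i x; case: (FP x).
- by move=> i x Sx; rewrite (decomp_inj (FP x) (hom _ _ Sx)) eqxx.
- by move=> i j x Sx /negbTE ji; rewrite (decomp_inj (FP x) (hom _ _ Sx)) ji.
- by move=> x; case: (FP x) => _ [s [us fs e]]; exists s.
Qed.

End DirectSum.

Section Projections.
Variables (I : eqType) (M : zmodType) (S : I -> M -> Prop) (pr : I -> M -> M).
Hypothesis prP : projections S pr.

Lemma projB i x y : pr i (x - y) = pr i x - pr i y. Proof. by case: prP. Qed.
Lemma projS i x : S i (pr i x). Proof. by case: prP. Qed.
Lemma proj_id i x : S i x -> pr i x = x. Proof. by case: prP => _ _ h _ _; apply: h. Qed.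
Lemma proj_neq i j x : S i x -> j != i -> pr j x = 0.
Proof. by case: prP => _ _ _ h _; apply: h. Qed.
Lemma proj_sumE x : exists s, [/\ uniq s, forall i, i \notin s -> pr i x = 0
                             & x = \sum_(i <- s) pr i x].
Proof. by case: prP. Qed.

Lemma proj0 i : pr i 0 = 0. Proof. by have := projB i 0 0; rewrite !subrr. Qed.
Lemma projN i x : pr i (- x) = - pr i x.
Proof. by have := projB i 0 x; rewrite proj0 !sub0r. Qed.
Lemma projD i x y : pr i (x + y) = pr i x + pr i y.
Proof. by have := projB i x (- y); rewrite projN !opprK. Qed.
Lemma proj_sum (J : Type) i (s : seq J) (f : J -> M) :
  pr i (\sum_(j <- s) f j) = \sum_(j <- s) pr i (f j).
Proof. by elim/big_rec2: _ => [|j y1 y2 _ <-]; rewrite ?proj0 ?projD. Qed.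

Lemma proj_eq0 x : (forall i, pr i x = 0) -> x = 0.
Proof. by move=> h; have [s [_ _ ->]] := proj_sumE x; rewrite big1. Qed.

(** The image under  g  of the decomposition of  x  is a decomposition of  g x.
   With  g  a multiplication by a homogeneous element, a scaling or a
   differential, all later degree arguments reduce to this one. *)
Lemma proj_shift (J : eqType) (N : zmodType) (S' : J -> N -> Prop) pr'
    (g : N -> M) (sh : J -> I) :
  projections S' pr' -> (forall x y, g (x - y) = g x - g y) -> injective sh ->
  (forall j x, S' j x -> S (sh j) (g x)) ->
  (forall j x, pr (sh j) (g x) = g (pr' j x)) /\
  (forall i x, (forall j, i != sh j) -> pr i (g x) = 0).
Proof.
move=> pr'P gB shI gS.
have g0 : g 0 = 0 by have := gB 0 0; rewrite !subrr.
have gD x y : g (x + y) = g x + g y.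
  by have := gB (x + y) y; rewrite addrK => ->; rewrite subrK.
have gsum (s : seq J) f : g (\sum_(j <- s) f j) = \sum_(j <- s) g (f j).
  by elim/big_rec2: _ => [|j y1 y2 _ <-].
case: pr'P => _ pS _ _ psum.
split=> [j x|i x nsh]; have [s [us sz e]] := psum x; rewrite {1}e gsum proj_sum.
  case: (boolP (j \in s)) => [js|/[dup] njs /sz ->]; last first.
    rewrite g0 big_seq big1 // => l ls; apply: proj_neq (gS _ _ (pS l x)) _.
    by rewrite (inj_eq shI); apply: contraNneq njs => ->.
  rewrite (bigD1_seq j) //= proj_id; last exact/gS/pS.
  rewrite big1 ?addr0 // => l lj; apply: proj_neq (gS _ _ (pS l x)) _.
  by rewrite (inj_eq shI) eq_sym.
by rewrite big1 // => l _; apply: proj_neq (gS _ _ (pS l x)) _.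
Qed.

End Projections.

Section FreeFamily.
Variables (R : nzRingType) (M : lmodType R) (I : eqType) (b : I -> M).

Definition spanning : Prop :=
  forall x, exists (s : seq I) (c : I -> R), x = \sum_(i <- s) c i *: b i.
Definition free_family : Prop :=
  forall (s : seq I) (c : I -> R), uniq s ->
    \sum_(i <- s) c i *: b i = 0 -> forall i, i \in s -> c i = 0.

Hypotheses (sb : spanning) (fb : free_family).

Let line i x := exists c : R, x = c *: b i.

Let line_direct : direct_sum line.
Proof.
split.
- move=> i; split; first by exists 0; rewrite scale0r.
  by move=> _ _ [c ->] [d ->]; exists (c - d); rewrite scalerBl.
- move=> x; have [s [c ->]] := sb x; exists s, (fun i => c i *: b i); split=> //.
  by move=> i; exists (c i).
- move=> s f us /choice[c fc]; under eq_bigr do rewrite fc; move=> e i is_.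
  by rewrite fc (fb us e) ?scale0r.
Qed.

Lemma free_neq0 i : b i <> 0.
Proof.
move=> e; have := @fb [:: i] (fun=> 1) isT; rewrite big_seq1 e scaler0.
by move=> /(_ erefl i (mem_head _ _)) /eqP; rewrite oner_eq0.
Qed.

(** The coordinates come from the decomposition of  M  into the lines  R b_i. *)
Lemma free_universal (N : lmodType R) (y : I -> N) :
  exists h : {linear M -> N}, forall i, h (b i) = y i.
Proof.
have [pr prP] := direct_sum_proj line_direct.
have [_ prS prid pr0 prsum] := prP.
have b0 c i : c *: b i = 0 -> c = 0.
  move=> e; have := @fb [:: i] (fun=> c) isT; rewrite big_seq1.
  by move=> /(_ e i (mem_head _ _)).
have [co coP] : exists co : M -> I -> R, forall x i, pr i x = co x i *: b i.
  apply: (choice_ex (P := fun x (c : I -> R) => forall i, pr i x = c i *: b i)) => x.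
  exact: choice_ex (fun i => prS i x).
have [sp spP] := choice prsum.
have co0 x i : i \notin sp x -> co x i = 0.
  by case: (spP x) => _ h _ /h; rewrite coP => /b0.
have prZ i c x : pr i (c *: x) = c *: pr i x.
  have := proj_shift (g := fun x => c *: x) (sh := id) prP prP.
  case=> // [x1 x2|j x1 [d ->]]; first by rewrite scalerBr.
  by exists (c * d); rewrite scalerA.
have coZD c x z i : co (c *: x + z) i = c * co x i + co z i.
  apply/eqP; rewrite -subr_eq0; apply/eqP; apply: (b0 _ i).
  by rewrite scalerBl scalerDl -scalerA -!coP -prZ -(projD prP) subrr.
pose f x := \sum_(i <- sp x) co x i *: y i.
have fE x t : uniq t -> {subset sp x <= t} -> f x = \sum_(i <- t) co x i *: y i.
  move=> ut st; apply: eq_big_support => //; first by case: (spP x).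
  by move=> i /co0 ->; rewrite scale0r.
have lf : linear f.
  move=> c x z; pose t := undup (sp (c *: x + z) ++ sp x ++ sp z).
  rewrite !(fE _ t) ?undup_uniq //; try by
    move=> i is_; rewrite mem_undup !mem_cat is_ ?orbT.
  rewrite scaler_sumr -big_split; apply: eq_bigr => i _ /=.
  by rewrite coZD scalerDl scalerA.
have [h hE] := linear_bundle lf; exists h => i; rewrite hE.
have bl : line i (b i) by exists 1; rewrite scale1r.
have coi : co (b i) i = 1.
  by apply/eqP; rewrite -subr_eq0; apply/eqP; apply: (b0 _ i);
    rewrite scalerBl -coP prid // scale1r subrr.
have coj j : j != i -> co (b i) j = 0.
  by move=> ji; apply: (b0 _ j); rewrite -coP (pr0 i).
have is_ : i \in sp (b i).
  by apply: contraT => /co0; rewrite coi => /eqP; rewrite oner_eq0.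
rewrite /f (bigD1_seq i) //=; last by case: (spP (b i)).
by rewrite coi scale1r big1 ?addr0 // => j /coj ->; rewrite scale0r.
Qed.

Lemma linear_span_eq (N : lmodType R) (f g : {linear M -> N}) :
  (forall i, f (b i) = g (b i)) -> forall x, f x = g x.
Proof.
move=> e x; have [s [c ->]] := sb x; rewrite !linear_sum; apply: eq_bigr => i _.
by rewrite !linearZ /= e.
Qed.

Lemma free_projective : projective M.
Proof.
move=> A B g f sg; have [y yE] := choice (fun i => sg (f (b i))).
have [h hE] := free_universal y; exists h => x.
apply: (@linear_span_eq B (g \o h) f) => i /=.
by rewrite hE.
Qed.

(** Repeated indices are merged by adding up their coefficients. *)
Lemma spanning_uniq x (s : seq I) (c : I -> R) : x = \sum_(i <- s) c i *: b i ->
  exists2 c' : I -> R, (forall i, i \notin s -> c' i = 0) & x = \sum_(i <- undup s) c' i *: b i.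
Proof.
move=> ->; exists (fun i => if i \in s then c i *+ count_mem i s else 0).
  by move=> i /negbTE ->.
rewrite -big_undup_iterop_count; apply: eq_big_seq => i; rewrite mem_undup => ->.
by rewrite -[LHS]/(c i *: b i *+ count_mem i s) scalerMnl.
Qed.

End FreeFamily.

(** * Lifting maps out of projective modules *)

Section Image.
Variables (R : nzRingType) (M N : lmodType R) (g : {linear M -> N}).

(** Projectivity is a lifting property along surjections; to lift through an
   arbitrary  g  one corestricts it to its image. *)
Definition image_pred : {pred N} := fun y => `[< exists x, g x = y >].

Lemma image_pred_closed : submod_closed image_pred.
Proof.
split; first by apply/asboolP; exists 0; rewrite linear0.
move=> c _ _ /asboolP[x <-] /asboolP[z <-]; apply/asboolP; exists (c *: x + z).
by rewrite linearP.
Qed.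

HB.instance Definition _ := GRing.isSubmodClosed.Build R N image_pred
  (image_pred_closed).

Record image := Image { image_val : N; _ : image_val \in image_pred }.

HB.instance Definition _ := [isSub of image for image_val].
HB.instance Definition _ := [Choice of image by <:].
HB.instance Definition _ := [SubChoice_isSubLmodule of image by <:].

End Image.

Lemma projective_lift (R : nzRingType) (P M N : lmodType R)
    (g : {linear M -> N}) (f : {linear P -> N}) :
  projective P -> (forall x, exists y, g y = f x) ->
  exists h : {linear P -> M}, forall x, g (h x) = f x.
Proof.
move=> prP fg.
have gm x : g x \in image_pred g by apply/asboolP; exists x.
have fm x : f x \in image_pred g by apply/asboolP.
pose g1 x : image g := Image (gm x); pose f1 x : image g := Image (fm x).
have lg1 : linear g1 by move=> c x y; apply: val_inj; rewrite /= linearP.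
have lf1 : linear f1 by move=> c x y; apply: val_inj; rewrite /= linearP.
have [g2 g2E] := linear_bundle lg1; have [f2 f2E] := linear_bundle lf1.
have sg2 : surjective g2.
  move=> [y /= ym]; have /asboolP[x xy] := ym; exists x; rewrite g2E.
  exact: val_inj.
have [h hE] := prP _ _ g2 f2 sg2; exists h => x.
by have := congr1 val (hE x); rewrite g2E f2E.
Qed.

(** * Comparison of resolutions *)

Lemma lift_zero (R : nzRingType) (M : lmodType R) (P : chain R)
    (e : {linear P 0%N -> M}) (L : lmodType R) :
  resolution e -> projective L ->
  [/\ forall f : {linear L -> M}, exists h : {linear L -> P 0%N}, forall x, e (h x) = f x,
      forall f : {linear L -> P 0%N}, (forall x, e (f x) = 0) ->
        exists h : {linear L -> P 1%N}, forall x, diff P 0 (h x) = f x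
    & forall n (f : {linear L -> P n.+1}), (forall x, diff P n (f x) = 0) ->
        exists h : {linear L -> P n.+2}, forall x, diff P n.+1 (h x) = f x].
Proof.
move=> [se e0 en] pL; split.
- by move=> f; apply: projective_lift => // x; apply: se.
- by move=> f f0; apply: projective_lift => // x; apply/e0.
- by move=> n f f0; apply: projective_lift => // x; apply/en.
Qed.

(** Lift the identity of  M  to chain maps  a : P -> Q  and  b : Q -> P.  The
   composite  b a  is homotopic to the identity of  P,  and in degree 3 it does
   not contribute because  Q_3 = 0. *)
Lemma homotopy_to_short_resolution (R : nzRingType) (M : lmodType R) (P Q : chain R)
    (e : {linear P 0%N -> M}) (e' : {linear Q 0%N -> M}) :
  resolution e -> resolution e' ->
  (forall n, projective (P n)) -> (forall n, projective (Q n)) ->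
  (forall x : Q 3%N, x = 0) ->
  exists h : {linear P 2%N -> P 3%N}, forall x, exists z,
    x = diff P 3 z - h (diff P 2 x).
Proof.
move=> rP rQ pP pQ Q3.
have [_ e0P dP] := rP; have [_ e0Q dQ] := rQ.
have ddP n x : diff P n (diff P n.+1 x) = 0 by apply/dP; exists x.
have ddQ n x : diff Q n (diff Q n.+1 x) = 0 by apply/dQ; exists x.
have edP x : e (diff P 0 x) = 0 by apply/e0P; exists x.
have edQ x : e' (diff Q 0 x) = 0 by apply/e0Q; exists x.
have [liftP0 _ _] := lift_zero rQ (pP 0%N).
have [a0 a0E] := liftP0 e.
have [_ liftP1 _] := lift_zero rQ (pP 1%N).
have [|a1 a1E] := liftP1 (a0 \o diff P 0) => [x /=|]; first by rewrite a0E edP.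
have [_ _ liftP2] := lift_zero rQ (pP 2%N).
have [|a2 a2E] := liftP2 _ (a1 \o diff P 1) => [x /=|].
  by rewrite a1E /= ddP linear0.
have a2d x : a2 (diff P 2 x) = 0.
  have /dQ[y <-] : diff Q 1 (a2 (diff P 2 x)) = 0 by rewrite a2E /= ddP linear0.
  by rewrite (Q3 y) linear0.
have [liftQ0 _ _] := lift_zero rP (pQ 0%N).
have [b0 b0E] := liftQ0 e'.
have [_ liftQ1 _] := lift_zero rP (pQ 1%N).
have [|b1 b1E] := liftQ1 (b0 \o diff Q 0) => [x /=|]; first by rewrite b0E edQ.
have [_ _ liftQ2] := lift_zero rP (pQ 2%N).
have [|b2 b2E] := liftQ2 _ (b1 \o diff Q 1) => [x /=|].
  by rewrite b1E /= ddQ linear0.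
have [_ liftH0 _] := lift_zero rP (pP 0%N).
have [|h0 h0E] := liftH0 ((b0 \o a0) \- idfun) => [x /=|].
  by rewrite linearB /= b0E a0E subrr.
have [_ _ liftH1] := lift_zero rP (pP 1%N).
have [|h1 h1E] := liftH1 _ ((b1 \o a1) \- idfun \- (h0 \o diff P 0)) => [x /=|].
  by rewrite !linearB /= b1E /= a1E h0E /= subrr.
have [_ _ liftH2] := lift_zero rP (pP 2%N).
have [|h2 h2E] := liftH2 _ ((b2 \o a2) \- idfun \- (h1 \o diff P 1)) => [x /=|].
  by rewrite !linearB /= b2E /= a2E h1E /= ddP linear0 subr0 subrr.
exists h2 => x.
have /dP[z zE] : diff P 2 (x + h2 (diff P 2 x)) = 0.
  rewrite linearD h2E /= a2d ddP.
  by rewrite (linear0 b2) (linear0 h1) subr0 sub0r subrr.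
by exists z; rewrite zE addrK.
Qed.

(** * Connected graded algebras and modules *)

Section ConnectedGraded.
Variables (k : fieldType) (T : algType k) (G : nat -> T -> Prop).
Hypothesis cg : connected_graded G.

Lemma subspaceG n : subspace (G n). Proof. by case: cg. Qed.
Lemma grade0 n : G n 0. Proof. by case: (subspaceG n). Qed.
Lemma gradeZD n c x y : G n x -> G n y -> G n (c *: x + y).
Proof. by case: (subspaceG n) => _; apply. Qed.
Lemma gradeD n x y : G n x -> G n y -> G n (x + y).
Proof. by move=> gx gy; rewrite -[x]scale1r; apply: gradeZD. Qed.
Lemma gradeZ n c x : G n x -> G n (c *: x).
Proof. by move=> gx; rewrite -[_ *: _]addr0; apply: gradeZD gx (grade0 n). Qed.
Lemma grade_sum n (J : eqType) (s : seq J) (f : J -> T) :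
  (forall j, j \in s -> G n (f j)) -> G n (\sum_(j <- s) f j).
Proof.
by move=> h; rewrite big_seq; apply: big_ind => // [|x y]; [exact: grade0 | exact: gradeD].
Qed.
Lemma gradeM m n x y : G m x -> G n y -> G (m + n) (x * y).
Proof. by case: cg => _ _ h _; apply: h. Qed.
Lemma grade0E x : G 0 x <-> exists c : k, x = c%:A.
Proof. by case: cg. Qed.
Lemma grade_one : G 0 1. Proof. by apply/grade0E; exists 1; rewrite scale1r. Qed.

Lemma alg_inj (c d : k) : c%:A = d%:A :> T -> c = d.
Proof.
move/eqP; rewrite -subr_eq0 -scalerBl scaler_eq0 oner_eq0 orbF subr_eq0.
by move/eqP.
Qed.

Lemma int_gradedM a b x y :
  int_graded G a x -> int_graded G b y -> int_graded G (a + b) (x * y).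
Proof.
case: a => [m|m] /=; last by move=> -> _; rewrite mul0r; case: (_ + b) => //= ?; apply: grade0.
case: b => [n|n] /=; last by move=> _ ->; rewrite mulr0; case: (Posz m + _) => //= ?; apply: grade0.
exact: gradeM.
Qed.

Lemma int_graded0 a : int_graded G a 0.
Proof. by case: a => //= n; apply: grade0. Qed.

Lemma int_graded_sum a (J : eqType) (s : seq J) (f : J -> T) :
  (forall j, j \in s -> int_graded G a (f j)) -> int_graded G a (\sum_(j <- s) f j).
Proof.
case: a => n /=; first exact: grade_sum.
by move=> h; rewrite big_seq big1.
Qed.

Lemma graded_proj : exists pr, projections G pr.
Proof. by case: cg => _ /direct_sum_proj. Qed.

Variable pr : nat -> T -> T.
Hypothesis prP : projections G pr.

Lemma projMr m y : G m y -> forall j s, pr (j + m) (s * y) = pr j s * y.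
Proof.
move=> gy j s; have [|||h _] := proj_shift (g := fun s => s * y) (sh := addn^~ m) prP prP.
- by move=> a b; rewrite mulrBl.
- exact: addIn.
- by move=> i x gx; apply: gradeM.
exact: h.
Qed.

Lemma projMr_lt m y : G m y -> forall j s, (j < m)%N -> pr j (s * y) = 0.
Proof.
move=> gy j s jm; have [|||_ h] := proj_shift (g := fun s => s * y) (sh := addn^~ m) prP prP.
- by move=> a b; rewrite mulrBl.
- exact: addIn.
- by move=> i x gx; apply: gradeM.
by apply: h => i; apply: contraTneq jm => ->; rewrite -leqNgt leq_addl.
Qed.

Lemma projMl_lt m y : G m y -> forall j s, (j < m)%N -> pr j (y * s) = 0.
Proof.
move=> gy j s jm; have [|||_ h] := proj_shift (g := fun s => y * s) (sh := addn m) prP prP.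
- by move=> a b; rewrite mulrBr.
- exact: addnI.
- by move=> i x gx; apply: gradeM.
by apply: h => i; apply: contraTneq jm => ->; rewrite -leqNgt leq_addr.
Qed.

Lemma projZ j c x : pr j (c *: x) = c *: pr j x.
Proof.
have [|||h _] := proj_shift (g := fun s => c *: s) (sh := id) prP prP.
- by move=> a b; rewrite scalerBr.
- by [].
- by move=> i y; apply: gradeZ.
exact: h.
Qed.

Lemma augmentation_ex : exists eps : T -> k, forall x, pr 0 x = (eps x)%:A.
Proof.
have h x : exists c : k, pr 0 x = c%:A by apply/grade0E; apply: projS prP _ _.
by have [eps ?] := choice h; exists eps.
Qed.

Lemma proj0M x y : pr 0 (x * y) = pr 0 x * pr 0 y.
Proof.
have [s [us sz e]] := proj_sumE prP x.
have sc z t : G 0 z -> pr 0 (z * t) = z * pr 0 t.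
  by move=> /grade0E[c ->]; rewrite -!scalerAl !mul1r projZ.
rewrite {1}e mulr_suml (proj_sum prP).
case: (boolP (0%N \in s)) => [s0|/[dup] ns /sz ->]; last first.
  rewrite mul0r big_seq big1 // => -[|l] ls; first by rewrite ls in ns.
  by apply: projMl_lt (projS prP _ _) _ _ _.
rewrite (bigD1_seq 0%N) //= sc; last exact: projS prP _ _.
rewrite big1 ?addr0 // => -[|l] // _.
by apply: projMl_lt (projS prP _ _) _ _ _.
Qed.

Lemma positive_partP a : positive_part G a <-> pr 0 a = 0.
Proof.
split=> [[s [f [sf ->]]]|a0].
  rewrite (proj_sum prP) big_seq big1 // => i /sf[i0 gi].
  by apply: (proj_neq prP) gi _; rewrite eq_sym -lt0n.
have [s [us sz e]] := proj_sumE prP a.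
exists [seq i <- s | i != 0%N], (fun i => pr i a); split.
  by move=> i; rewrite mem_filter lt0n => /andP[-> _]; split=> //; apply: projS prP _ _.
rewrite {1}e big_filter [LHS](bigID (pred1 0%N)) /= big1 ?add0r // => i /eqP ->.
exact: a0.
Qed.

(** The augmentation  T -> k  as a ring morphism. *)
Lemma augmentation : exists eps : {rmorphism T -> k}, forall x, pr 0 x = (eps x)%:A.
Proof.
have [eps epsE] := augmentation_ex.
have aB : zmod_morphism eps.
  by move=> x y; apply: alg_inj; rewrite scalerBl -!epsE (projB prP).
have aM : monoid_morphism eps.
  split; first by apply: alg_inj; rewrite -epsE (proj_id prP grade_one) scale1r.
  move=> x y; apply: alg_inj.
  by rewrite -epsE proj0M !epsE -scalerAl mul1r scalerA.
pose h : {rmorphism T -> k} := HB.pack eps (GRing.isZmodMorphism.Build _ _ eps aB)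
   (GRing.isMonoidMorphism.Build _ _ eps aM).
by exists h.
Qed.

Section GradedModule.
Variables (M : lmodType T) (Mg : int -> M -> Prop).
Hypothesis gM : graded_module G Mg.

Lemma module_proj : exists prM, projections Mg prM.
Proof. by case: gM => /direct_sum_proj. Qed.

Section Basis.
Variables (n : int) (I : eqType) (b : I -> M).
Hypothesis bn : forall i, Mg n (b i).

(** Projecting the expansion of  x  to its degree replaces every coefficient by
   its component of degree  m;  freeness says that nothing has changed. *)
Lemma homogeneous_coords (m : int) x (s : seq I) (c : I -> T) :
  free_family b -> Mg (m + n) x -> uniq s -> x = \sum_(i <- s) c i *: b i ->
  forall i, i \in s -> int_graded G m (c i).
Proof.
move=> fb gx us e.
have [prM prMP] := module_proj.
pose c' i := if m is Posz q then pr q (c i) else 0.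
have cc' i : prM (m + n) (c i *: b i) = c' i *: b i.
  have [|||h1 h2] := proj_shift (g := fun t : T => t *: b i)
    (sh := fun q : nat => q%:Z + n) prMP prP.
  - by move=> x1 x2; rewrite scalerBl.
  - by move=> q1 q2 /addIr [].
  - by move=> q t gt; case: gM => _; apply.
  rewrite /c'; case: (m) => q; first exact: h1.
  by rewrite scale0r h2 // => j; rewrite (inj_eq (addIr n)).
have x' : x = \sum_(i <- s) c' i *: b i.
  by rewrite -(proj_id prMP gx) e (proj_sum prMP); apply: eq_bigr.
have z : \sum_(i <- s) (c i - c' i) *: b i = 0.
  rewrite (eq_bigr (fun i => c i *: b i - c' i *: b i)); last by move=> i _; rewrite scalerBl.
  by rewrite sumrB -e -x' subrr.
move=> i is_; have /eqP := fb _ _ us z i is_; rewrite subr_eq0 => /eqP ->.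
by rewrite /c'; case: (m) => //= q; apply: projS prP _ _.
Qed.

(** T  has no elements of negative degree. *)
Lemma homogeneous_zero (m : int) x :
  spanning b -> (m < n) -> Mg m x -> x = 0.
Proof.
move=> sb mn gx; have [s [c e]] := sb x; have [prM prMP] := module_proj.
rewrite -(proj_id prMP gx) e (proj_sum prMP) big1 // => i _.
have [|||_ h2] := proj_shift (g := fun t : T => t *: b i) (sh := fun q : nat => q%:Z + n) prMP prP.
- by move=> x1 x2; rewrite scalerBl.
- by move=> q1 q2 /addIr [].
- by move=> q t gt; case: gM => _; apply.
by apply: h2 => j; apply: contraTneq mn => ->; rewrite -Order.TotalTheory.leNgt Num.Theory.lerDr.
Qed.

Lemma cochain_extend (j : int) (y : I -> T) :
  spanning b -> free_family b -> (forall i, int_graded G (n + j) (y i)) ->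
  exists h : {linear M -> T^o}, (forall i, h (b i) = y i) /\
    forall q x, Mg q x -> int_graded G (q + j) (h x).
Proof.
move=> sb fb gy; have [h hE] := free_universal sb fb (y : I -> T^o).
exists h; split=> // q x gx.
have [s [c e]] := sb x; have [c' _ e'] := spanning_uniq e.
rewrite e' linear_sum; apply: int_graded_sum => i is_.
rewrite linearZ /= hE -[q](subrK n) -addrA; apply: int_gradedM => //.
by apply: homogeneous_coords e' i is_; rewrite ?undup_uniq ?subrK.
Qed.

End Basis.
End GradedModule.

(** T  acts on its trivial module through the augmentation. *)
Lemma residue_facts (K : lmodType T) : residue_module G K ->
  exists pi : {linear T^o -> K}, [/\ surjective pi, forall a, pi a = 0 <-> pr 0 a = 0,
     pi 1 != 0, forall a, pi a = pi (pr 0 a) & forall n a y, G n.+1 a -> a *: y = 0 :> K].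
Proof.
move=> [pi [spi pi0]].
have pi0' a : pi a = 0 <-> pr 0 a = 0.
  by split=> [/pi0/positive_partP|/positive_partP/pi0].
exists pi; split=> //.
- by apply/eqP => /pi0'; rewrite (proj_id prP grade_one) => /eqP; rewrite oner_eq0.
- move=> a; apply/eqP; rewrite -subr_eq0 -linearB; apply/eqP/pi0'.
  by rewrite (projB prP) (proj_id prP (projS prP 0%N a)) subrr.
- move=> n a y ga; have [t <-] := spi y; rewrite -linearZ; apply/pi0'.
  exact: projMl_lt ga _ _ _.
Qed.

End ConnectedGraded.

(** * The Koszul resolution of the trivial module *)

Section Restriction.
Variables (A : nzRingType) (k : fieldType).

(** The line  k  on which  A  acts through an augmentation; for  A  the converse
   ring of  T  it is the trivial right module. *)
Definition restriction (eps : {rmorphism A -> k}) : Type := k.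
HB.instance Definition _ eps := GRing.Zmodule.copy (restriction eps) k.

Variable eps : {rmorphism A -> k}.

Let rscale (a : A) (x : restriction eps) : restriction eps := eps a * (x : k).
Fact rscaleA a b x : rscale a (rscale b x) = rscale (a * b) x.
Proof. by rewrite /rscale rmorphM mulrA. Qed.
Fact rscale1 : left_id 1 rscale.
Proof. by move=> x; rewrite /rscale rmorph1 mul1r. Qed.
Fact rscaleDr : right_distributive rscale +%R.
Proof. by move=> a x y; rewrite /rscale; exact: mulrDr. Qed.
Fact rscaleDl x : {morph rscale^~ x : a b / a + b}.
Proof. by move=> a b; rewrite /rscale rmorphD; exact: mulrDl. Qed.
HB.instance Definition _ := GRing.Zmodule_isLmodule.Build A (restriction eps)
  rscaleA rscale1 rscaleDr rscaleDl.

End Restriction.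

Section KoszulResolution.
Variables (k : fieldType) (T : algType k) (G : nat -> T -> Prop).
Hypothesis cg : connected_graded G.
Variable pr : nat -> T -> T.
Hypothesis prP : projections G pr.

Variables (K : lmodType T) (P : chain T) (Pg : forall n, int -> P n -> Prop)
          (e : {linear P 0%N -> K}).
Hypotheses (resK : residue_module G K) (grP : graded_resolution G Pg e).
Hypothesis bas : forall n, basis_in_degree (@Pg n) n%:Z.

Let resP : resolution e. Proof. by case: grP. Qed.
Let gmP n : graded_module G (@Pg n). Proof. by case: grP. Qed.
Let gdiff n j x : @Pg n.+1 j x -> @Pg n j (diff P n x).
Proof. by case: grP => _ _ h _; apply: h. Qed.
Let ddP n x : diff P n (diff P n.+1 x) = 0.
Proof. by case: resP => _ _ h; apply/h; exists x. Qed.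

(** P_{n+1}  starts in degree  n + 1. *)
Lemma top_diff_eq0 n x y : @Pg n n%:Z x -> x = diff P n y -> x = 0.
Proof.
move=> gx xy; have [pM pMP] := module_proj (gmP n).
have [pM' pM'P] := module_proj (gmP n.+1).
have [|||h _] := proj_shift (g := diff P n) (sh := id) pMP pM'P.
- by move=> a b; rewrite linearB.
- by [].
- exact: gdiff.
have [I [b [bn sb _]]] := bas n.+1.
have y0 : pM' n%:Z y = 0.
  apply: (homogeneous_zero prP (gmP n.+1) bn sb (m := n%:Z)); last exact: projS pM'P _ _.
  by rewrite ltz_nat.
by rewrite -(proj_id pMP gx) xy h y0 linear0.
Qed.

(** Minimality: the differential has coefficients in  T_1,  which annihilates the
   trivial module. *)
Lemma residue_map_diff n (phi : {linear P n -> K}) x : phi (diff P n x) = 0.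
Proof.
have [_ [_ _ _ _ Kpos]] := residue_facts cg prP resK.
have [I [b [bn sb _]]] := bas n.+1; have [J [b' [bn' sb' fb']]] := bas n.
have [s [c ->]] := sb x; rewrite !linear_sum big1 // => i _.
rewrite !linearZ /=.
have [t [d e1]] := sb' (diff P n (b i)); have [d' _ e2] := spanning_uniq e1.
have gd : @Pg n (1 + n%:Z) (diff P n (b i)) by have := gdiff (bn i); rewrite -intS.
have d1 := homogeneous_coords prP (gmP n) bn' fb' gd (undup_uniq t) e2.
rewrite e2 linear_sum big_seq big1 ?scaler0 // => j /d1 /= dj.
by rewrite linearZ /= (Kpos 0%N).
Qed.

(** A linear map from  P_3  to the trivial module kills both  d z  and  h (d x)
   in the homotopy formula  x = d z - h (d x),  hence is zero; so  P_3,  being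
   free, has an empty basis. *)
Lemma diff1_injective : gldim_le T 2 -> forall x : P 2%N, diff P 1 x = 0 -> x = 0.
Proof.
move=> gl x dx; have [Q [e' [rQ pQ Q0]]] := gl K.
have pP n : projective (P n).
  by have [I [b [_ sb fb]]] := bas n; apply: free_projective sb fb.
have [h hE] := homotopy_to_short_resolution resP rQ pP pQ (Q0 3%N isT).
have [pi [_ _ pi1 _ _]] := residue_facts cg prP resK.
have [_ _ /(_ _ x)[/(_ dx)[y <-] _]] := resP.
have [I [b [_ sb fb]]] := bas 3%N.
have [s [c ->]] := sb y; rewrite linear_sum big1 // => i _.
have [phi phiE] := free_universal sb fb (fun=> pi 1).
have [z bz] := hE (b i).
case/eqP: pi1; rewrite -(phiE i) bz linearB (residue_map_diff phi) sub0r.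
by have /= -> := residue_map_diff (phi \o h) (b i); rewrite oppr0.
Qed.

Lemma diff_basis_coords n (I J : eqType) (b : I -> P n.+1) (c : J -> P n) i :
  (forall i, @Pg n.+1 n.+1%:Z (b i)) -> (forall j, @Pg n n%:Z (c j)) ->
  spanning c -> free_family c ->
  exists s (a : J -> T), [/\ uniq s, forall j, j \in s -> G 1 (a j) &
    diff P n (b i) = \sum_(j <- s) a j *: c j].
Proof.
move=> gb gc sc fc; have [s [a0 e0]] := sc (diff P n (b i)).
have [a _ e1] := spanning_uniq e0; exists (undup s), a; split=> //.
  exact: undup_uniq.
have gd : @Pg n (1 + n%:Z) (diff P n (b i)) by have := gdiff (gb i); rewrite -intS.
exact: (homogeneous_coords prP (gmP n) gc fc gd (undup_uniq s) e1).
Qed.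

(** The augmentation  e  is injective in degree 0 and takes values in a line, so
   P_0  has exactly one generator. *)
Lemma term0_rank_one : exists b0 : P 0%N,
  [/\ @Pg 0%N 0 b0, forall x, exists t, x = t *: b0, forall t, t *: b0 = 0 -> t = 0
    & forall t, e (t *: b0) = 0 <-> pr 0 t = 0].
Proof.
have [pi [spi pi0 pi1 pip Kpos]] := residue_facts cg prP resK.
have [I [b [gb sb fb]]] := bas 0%N.
have [se e0 _] := resP.
have e_inj x : @Pg 0%N 0 x -> e x = 0 -> x = 0.
  by move=> gx /e0[y yx]; apply: top_diff_eq0 gx (esym yx).
have Ksc y : exists c : k, y = pi c%:A.
  have [a <-] := spi y; have /(grade0E cg)[c cE] := projS prP 0%N a.
  by exists c; rewrite pip cE.
have [c cE] := choice (fun i => Ksc (e (b i))).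
have c0 i : c i != 0.
  apply/eqP => ci0; apply: (free_neq0 fb (i := i)); apply: e_inj => //.
  by rewrite cE ci0 scale0r linear0.
have piA (x : k) : pi x%:A = (x%:A : T) *: pi 1 by rewrite -linearZ; congr (pi _); exact/esym/mulr1.
have uni (i j : I) : i = j.
  apply/eqP; apply: contraT => ij.
  have z : \sum_(l <- [:: i; j]) (if l == i then (c j)%:A else - (c i)%:A : T) *: b l = 0.
    rewrite big_cons big_seq1 eqxx [j == i]eq_sym (negbTE ij).
    apply: e_inj.
      case: (gmP 0%N) => -[/(_ 0)[_ gB] _ _] gs.
      rewrite scaleNr; apply: gB; [have := gs 0%N 0 (c j)%:A (b i)|have := gs 0%N 0 (c i)%:A (b j)].
        by apply=> //; apply/(grade0E cg); exists (c j).
      by apply=> //; apply/(grade0E cg); exists (c i).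
    rewrite linearD !linearZ /= !cE !piA !scalerA.
    by rewrite -!scalerAl mulN1r mul1r scalerN scaleNr !scalerA mulrC subrr.
  have := fb [:: i; j] _ _ z i (mem_head _ _); rewrite /= inE ij eqxx => /(_ isT) /eqP.
  by rewrite scaler_eq0 oner_eq0 orbF (negbTE (c0 j)).
have [i0 _] : exists i : I, True.
  have [y ye] := se (pi 1); have [[|i s] [d dE]] := sb y; last by exists i.
  by move: pi1; rewrite -ye dE big_nil linear0 eqxx.
exists (b i0); split=> //.
- move=> x; have [s [d dE]] := sb x; exists (\sum_(i <- s) d i).
  by rewrite dE scaler_suml; apply: eq_bigr => i _; rewrite (uni i i0).
- move=> t t0; apply: (fb [:: i0] (fun=> t) isT _ i0 (mem_head _ _)).
  by rewrite big_seq1.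
- move=> t; have -> : e (t *: b i0) = pi (t * (c i0)%:A) by rewrite linearZ /= cE -linearZ.
  split=> [/pi0|h]; last by apply/pi0; rewrite (proj0M cg prP) h mul0r.
  rewrite (proj0M cg prP) (proj_id prP (x := (c i0)%:A)); last by apply/(grade0E cg); exists (c i0).
  rewrite -scalerAr mulr1 => h.
  have : (c i0)^-1 *: (c i0 *: pr 0 t) = 0 by rewrite h scaler0.
  by rewrite scalerA mulVf // scale1r.
Qed.

End KoszulResolution.

(** * Algebras with one nondegenerate quadratic relation *)

(** The relation  sum_i a_i v_i = 0  is the image of the generator of  P_2,  and
   exactness at  P_1  and  P_2  become the last two clauses.  Independence of
   the  a_i  says that the relation is a nondegenerate element of  V (x) V. *)
Definition one_relator (k : fieldType) (T : algType k) (G : nat -> T -> Prop) (n : nat)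
    (v a : 'I_n -> T) : Prop :=
  [/\ Defs.basis_of (G 1%N) v,
      (forall i, G 1%N (a i)) /\ forall c : 'I_n -> k, \sum_i c i *: a i = 0 -> forall i, c i = 0,
      forall m t, G m.+1 t ->
        exists2 c : 'I_n -> T, (forall i, G m (c i)) & t = \sum_i c i * v i,
      forall t : 'I_n -> T, \sum_i t i * v i = 0 ->
        exists s, forall i, t i = s * a i
    & \sum_i a i * v i = 0 /\ forall s, (forall i, s * a i = 0) -> s = 0].

(** The module that  Ext^2  is a shift of.  Its being a line bounds the number of
   relations, its being nonzero provides one. *)
Lemma residue_restriction (k : fieldType) (T : algType k) (G : nat -> T -> Prop) pr
    (cg : connected_graded G) (prP : projections G pr) :
  exists N : lmodType T^c, @residue_module T^c G N /\
    (exists y : N, y != 0) /\ (forall y z : N, y != 0 -> exists c : k, z = ((c%:A : T) : T^c) *: y).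
Proof.
have [eps epsE] := augmentation cg prP.
have epsA c : eps c%:A = c.
  apply: (@alg_inj _ T); rewrite -epsE (proj_id prP) //; apply/(grade0E cg).
  by exists c.
pose f : T^c -> k := eps.
have fB : zmod_morphism f by move=> x y; rewrite /f -rmorphB.
have fM : monoid_morphism f.
  split; first exact: (rmorph1 eps).
  by move=> x y; rewrite mulrC; exact: (rmorphM eps).
pose epsc : {rmorphism T^c -> k} := HB.pack f (GRing.isZmodMorphism.Build _ _ f fB)
   (GRing.isMonoidMorphism.Build _ _ f fM).
exists (restriction epsc); split; last split.
- pose g : (T^c)^o -> restriction epsc := f.
  have lg : linear g.
    move=> c x y; rewrite /g -[RHS]/(epsc c * epsc x + epsc y).
    by rewrite -rmorphM -rmorphD.
  have [h hE] := linear_bundle lg.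
  exists h; split=> [y|a].
    by exists (y : k)%:A; rewrite hE; apply: epsA.
  rewrite hE; split=> [ga|/(positive_partP prP)].
    by apply/(positive_partP prP); rewrite epsE -[eps a]/(g a) ga scale0r.
  by rewrite epsE => h0; apply: (@alg_inj _ T); rewrite [g a]/= h0 scale0r.
- by exists (1 : k); apply: oner_neq0.
- move=> y z y0; exists ((z : k) / (y : k)).
  rewrite -[RHS]/(eps ((z : k) / (y : k))%:A * (y : k)).
  by rewrite epsA divfK.
Qed.

(** Bases of  P_1  and  P_2  are the generators and the relations of  T.  Since
   Ext^2  is a line there is one relation, and  Ext^1 = 0  makes it
   nondegenerate. *)
Theorem koszul_AS_one_relator (k : fieldType) (T : algType k) (G : nat -> T -> Prop) l :
  connected_graded G -> gldim_le T 2 -> koszul G -> AS_gorenstein G 2 l ->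
  exists n (v a : 'I_n -> T), one_relator G v a.
Proof.
move=> cg gl [K [P [Pg [e [resK grP bas]]]]] hAS.
have [pr prP] := graded_proj cg.
have [resP gmP gdiff ge] := grP.
have inj2 := diff1_injective cg prP resK grP bas gl.
have [b0 [gb0 gen0 inj0 e0]] := term0_rank_one cg prP resK grP bas.
have [I [c [gc sc fc]]] := bas 1%N; have [J [r [gr sr fr]]] := bas 2%N.
have dd n x : diff P n (diff P n.+1 x) = 0.
  by case: resP => _ _ h; apply/h; exists x.
have ex0 x : e x = 0 -> exists y, diff P 0 y = x by case: resP => _ h _ /h.
have ex1 x : diff P 0 x = 0 -> exists y, diff P 1 y = x by case: resP => _ _ h /h.
have d3 (x : P 3%N) : diff P 2 x = 0 by apply: inj2; apply: dd.
(* The images of the basis of  P_1  are linear forms since the resolution is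
   linear; minimality makes them a basis of  T_1. *)
have [v vP] : exists v : I -> T, forall i, G 1%N (v i) /\ diff P 0 (c i) = v i *: b0.
  apply: (choice_ex (P := fun i t => G 1%N t /\ diff P 0 (c i) = t *: b0)) => i.
  have sb0 : spanning (fun _ : unit => b0).
    by move=> x; have [t ->] := gen0 x; exists [:: tt], (fun=> t); rewrite big_seq1.
  have fb0 : free_family (fun _ : unit => b0).
    move=> [|[] [|[] s]] // d _; rewrite big_seq1 => /inj0 d0 [] _; exact: d0.
  have [[|[] [|[] s]] [a [//= _ ga ->]]] :=
    diff_basis_coords prP grP i gc (fun _ : unit => gb0) sb0 fb0.
    by exists 0; rewrite big_nil scale0r; split=> //; apply: grade0 cg _.
  by exists (a tt); rewrite big_seq1; split=> //; apply: ga.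
have d0 s (t : I -> T) : diff P 0 (\sum_(i <- s) t i *: c i) = (\sum_(i <- s) t i * v i) *: b0.
  rewrite linear_sum scaler_suml; apply: eq_bigr => i _.
  by rewrite linearZ /= (vP i).2 scalerA.
have vgen m t : G m.+1 t -> exists s (d : I -> T), [/\ uniq s, forall i, i \in s -> G m (d i)
    & t = \sum_(i <- s) d i * v i].
  move=> gt; have [|y yt] := ex0 (t *: b0).
    by apply/e0; apply: (proj_neq prP) gt _.
  have [s [d0' e1]] := sc y; have [d _ e2] := spanning_uniq e1.
  have tE : t = \sum_(i <- undup s) d i * v i.
    apply/eqP; rewrite -subr_eq0; apply/eqP/inj0.
    by rewrite scalerBl -yt e2 d0 subrr.
  exists (undup s), (fun i => pr m (d i)); split; first exact: undup_uniq.
    by move=> i _; apply: projS prP _ _.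
  rewrite -(proj_id prP gt) tE (proj_sum prP); apply: eq_bigr => i _.
  by rewrite -addn1 (projMr cg prP (vP i).1).
have vsyz s (t : I -> T) : \sum_(i <- s) t i * v i = 0 ->
    exists y, diff P 1 y = \sum_(i <- s) t i *: c i.
  by move=> h; apply: ex1; rewrite d0 h scale0r.
have vfree s (d : I -> k) : uniq s -> \sum_(i <- s) d i *: v i = 0 -> forall i, i \in s -> d i = 0.
  move=> us h i is_; have [|y yE] := @vsyz s (fun i => (d i)%:A).
    by rewrite -[RHS]h; apply: eq_bigr => j _; rewrite -scalerAl mul1r.
  have z : \sum_(i <- s) (d i)%:A *: c i = 0.
    apply: (top_diff_eq0 prP grP bas (n := 1%N) (y := y)) => //.
    case: (gmP 1%N) => -[/(_ 1%N)[g0 gB] _ _] gs.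
    have gD x1 x2 : Pg 1%N 1 x1 -> Pg 1%N 1 x2 -> Pg 1%N 1 (x1 + x2).
      move=> h1 h2; rewrite -[x2]opprK; apply: (gB) => //; rewrite -sub0r; exact: gB.
    apply: big_ind => // j _; have := gs 0%N 1 (d j)%:A (c j); apply=> //.
    by apply/(grade0E cg); exists (d j).
  by have /eqP := fc _ _ us z i is_; rewrite scaler_eq0 oner_eq0 orbF => /eqP.
(* Since  P_3 -> P_2  vanishes, every cochain on  P_2  is a cocycle.  In degree
   -2 there are no coboundaries, as  P_1  is generated in degree 1. *)
have pP n : projective (P n).
  by have [I' [b [_ sb fb]]] := bas n; apply: free_projective sb fb.
have [ext0 ext2] := hAS K P Pg e resK (conj grP pP).
have [N [resN [[y0 y0n] Nline]]] := residue_restriction cg prP.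
have {ext2} [phi [_ phiD phiZ phi0 phisurj]] := ext2 N resN.
have cocyc j (f : P 2%N -> T) : cochain G Pg j f -> cocycle G Pg j f.
  move=> cf; split=> // x; rewrite d3; case: cf => lf _.
  by have [f' fE] := linear_bundle lf; rewrite -fE linear0.
have cochain0 j (f : P 1%N -> T) : cochain G Pg j f -> (1 + j < 0) -> forall x, f x = 0.
  move=> [lf gf] j1 x; have [f' fE] := linear_bundle lf.
  have [s [t ->]] := sc x; rewrite -fE linear_sum big1 // => i _.
  rewrite linearZ /= fE.
  have := gf _ _ (gc i); case: (1 + j) j1 => //= q _ ->.
  exact: mulr0.
have dual j (t : T) i : int_graded G (2%:Z + j) t ->
    exists f : P 2%N -> T, [/\ cochain G Pg j f, f (r i) = t & forall i', i' != i -> f (r i') = 0].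
  move=> gt; have [|f [fr' gf]] := cochain_extend cg prP (gmP 2%N) gr (j := j)
    (y := fun i' => if i' == i then t else 0) sr fr.
    by move=> i'; case: ifP => // _; apply: int_graded0 cg _.
  exists f; split; first by split=> //; exact: linearP.
    by rewrite fr' eqxx.
  by move=> i' /negbTE h; rewrite fr' h.
have notcob f i : cochain G Pg (-2) f -> f (r i) = 1 -> phi f != 0.
  move=> cf fi; apply/eqP => /(phi0 _ _ (cocyc _ _ cf)).1 [g [cg' fg]].
  move: fi; rewrite fg (cochain0 _ _ cg') // => /esym/eqP.
  by rewrite oner_eq0.
have int0 : int_graded G (2%:Z + (-2)) (1 : T) by exact: (grade_one cg).
have [j0 _] : exists j0 : J, True.
  have [|f cf fy] := phisurj (- l) y0; first by left; rewrite addrN.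
  have [h|h] := pselect (exists j : J, True); first exact: h.
  exfalso; move: y0n; rewrite -fy => /eqP; apply; apply/(phi0 _ _ cf).
  exists (fun=> 0); split.
    split; first by move=> ? ? ?; rewrite scaler0 addr0.
    by move=> n x _; apply: int_graded0 cg _.
  move=> x; have [[|j s] [t ->]] := sr x; last by case: h; exists j.
  by rewrite big_nil; case: cf => -[lf _] _; have [f' fE] := linear_bundle lf; rewrite -fE linear0.
have Jone j : j = j0.
  apply/eqP; apply: contraT => jj0.
  have [f [cf fj fz]] := dual (-2) 1 j0 int0.
  have [f' [cf' fj' fz']] := dual (-2) 1 j int0.
  have [d dE] := Nline (phi f) (phi f') (notcob _ _ cf fj).
  have gd : G 0%N (- d)%:A by apply/(grade0E cg); exists (- d).
  have cfd : cochain G Pg (-2) (fun x => f x * (- d)%:A).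
    case: cf => lf gf; split.
      move=> t x y; have [f1 f1E] := linear_bundle lf; rewrite -!f1E linearP.
      by rewrite mulrDl -!mulrA.
    by move=> n x /gf h; rewrite -[n + -2]addr0; apply: (int_gradedM cg (b := 0)).
  have cs : cochain G Pg (-2) (fun x => f x * (- d)%:A + f' x).
    case: cfd => lf gf; case: cf' => lf' gf'; split.
      move=> t x y; rewrite (lf t x y) (lf' t x y) /=.
      by rewrite scalerDr addrACA.
    move=> n x px; have := gf n x px; have := gf' n x px.
    case: (n + -2) => q /=; first by move=> h1 h2; apply: (gradeD cg h2 h1).
    by move=> -> ->; rewrite addr0.
  have nz : phi (fun x => f x * (- d)%:A + f' x) != 0.
    by apply: (notcob _ j cs); rewrite (fz j) // mul0r add0r.
  move/eqP: nz; case.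
  rewrite (phiD _ _ _ (cocyc _ _ cfd) (cocyc _ _ cf')) (phiZ _ _ _ _ (cocyc _ _ cf) gd) dE.
  by rewrite -scalerDl scaleNr addNr scale0r.
pose rho := r j0.
have rgen x : exists t, x = t *: rho.
  have [s [t ->]] := sr x; exists (\sum_(i <- s) t i); rewrite scaler_suml.
  by apply: eq_bigr => i _; rewrite (Jone i).
have rinj t : t *: rho = 0 -> t = 0.
  by move=> h; apply: (fr [:: j0] (fun=> t) isT _ j0 (mem_head _ _)); rewrite big_seq1.
have [s [a [us ga rhoE]]] := diff_basis_coords prP grP j0 gr gc sc fc.
(* A linear dependency between the  a_i  is a cocycle of degree -1 on  P_1;  its
   class vanishes, and  P_0  carries no nonzero cochain of degree -1.  Taking
   the dependency  delta_i  for an  i  absent from the relation shows that every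
   generator occurs in it, so there are finitely many. *)
have cochain1 (d : I -> k) : exists g : P 1%N -> T,
    cochain G Pg (-1) g /\ forall i, g (c i) = (d i)%:A.
  have [|g [gE gg]] := cochain_extend cg prP (gmP 1%N) gc (j := -1)
    (y := fun i => (d i)%:A) sc fc.
    by move=> i /=; apply/(grade0E cg); exists (d i).
  by exists g; split=> //; split=> //; exact: linearP.
have grho g (d : I -> k) : cochain G Pg (-1) g -> (forall i, g (c i) = (d i)%:A) ->
    g (diff P 1 rho) = \sum_(i <- s) d i *: a i.
  move=> [lg _] gE; have [g' g'E] := linear_bundle lg.
  rewrite rhoE -g'E linear_sum; apply: eq_bigr => i _.
  by rewrite linearZ /= g'E gE -[LHS]/(a i * (d i)%:A) -scalerAr mulr1.
have afree (d : I -> k) : \sum_(i <- s) d i *: a i = 0 -> forall i, d i = 0.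
  move=> h; have [g [cg' gE]] := cochain1 d.
  have [lg gg] := cg'; have [g' g'E] := linear_bundle lg.
  have [||g1 [[lg1 gg1] g1E]] := ext0 1%N _ (-1) g; first by [].
    split=> // y; have [t ->] := rgen y; rewrite linearZ -g'E linearZ /= g'E.
    by rewrite (grho g d) // h scaler0.
  move=> i; apply: (@alg_inj _ T); rewrite -gE g1E (vP i).2 scale0r.
  have [g1' g1'E] := linear_bundle lg1; rewrite -g1'E linearZ /= g1'E.
  by have /= -> := gg1 _ _ gb0; rewrite scaler0.
have sall i : i \in s.
  apply: contraT => is_; have := afree (fun j => (j == i)%:R) _ i.
  rewrite eqxx => /(_ _)/eqP; rewrite oner_eq0; apply.
  rewrite big_seq big1 // => j js; rewrite (_ : j == i = false) ?scale0r //.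
  by apply: contraNF is_ => /eqP <-.
pose o := tnth (in_tuple s).
have osum (M : zmodType) (F : I -> M) : \sum_(i <- s) F i = \sum_(i < size s) F (o i).
  by rewrite big_tnth.
have oinj : injective o by apply/tuple_uniqP.
have olift (M : zmodType) (d : 'I_(size s) -> M) : exists d' : I -> M, forall i, d' (o i) = d i.
  exists (fun i => \sum_(j < size s | o j == i) d j) => i.
  by rewrite (bigD1 i) //= big1 ?addr0 // => j /andP[/eqP /oinj ->]; rewrite eqxx.
have vgen' m t : G m.+1 t -> exists2 d : I -> T, forall i, G m (d i) & t = \sum_(i <- s) d i * v i.
  move=> /vgen[s' [d [us' gd ->]]]; exists (fun i => if i \in s' then d i else 0).
    by move=> i; case: ifP => [/gd //|_]; apply: grade0 cg _.
  rewrite -(eq_big_support us' us) => [|i _|i /negbTE ->]; [|exact: sall|exact: mul0r].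
  by apply: eq_big_seq => i ->.
have drho z : diff P 1 (z *: rho) = \sum_(i <- s) (z * a i) *: c i.
  by rewrite linearZ /= rhoE scaler_sumr; apply: eq_bigr => i _; rewrite scalerA.
exists (size s), (v \o o), (a \o o); split.
- split=> [d|t].
    have [d' dd'] := olift _ d; under eq_bigr do rewrite -dd'.
    rewrite -(osum _ (fun i => d' i *: v i)) => /(vfree _ _ us) h j.
    by rewrite -dd'; apply: h.
  split=> [/vgen'[d gd ->]|[d ->]]; last first.
    by apply: (grade_sum cg) => i _; apply: (gradeZ cg) (vP _).1.
  have [d' dE] : exists d' : I -> k, forall i, d i = (d' i)%:A.
    by apply: (choice_ex (P := fun i z => d i = z%:A)) => i; apply/(grade0E cg).
  exists (d' \o o); rewrite osum; apply: eq_bigr => i _ /=.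
  by rewrite dE -scalerAl mul1r.
- split=> [i|d]; first exact: ga _ (sall _).
  have [d' dd'] := olift _ d; under eq_bigr do rewrite -dd'.
  by rewrite -(osum _ (fun i => d' i *: a i)) => /afree h j; rewrite -dd'; apply: h.
- move=> m t /vgen'[d gd ->]; exists (d \o o) => [i|]; [exact: gd|by rewrite osum].
- move=> t; have [t' tt'] := olift _ t; under eq_bigr do rewrite -tt'.
  rewrite -(osum _ (fun i => t' i * v i)) => /vsyz[y]; have [z ->] := rgen y.
  rewrite drho => /eqP; rewrite -subr_eq0 -sumrB => /eqP h; exists z => j.
  have zt : z * a (o j) - t' (o j) = 0.
    apply: (fc s (fun i => z * a i - t' i) us _ (o j) (sall _)); rewrite -[RHS]h.
    by apply: eq_bigr => i _; rewrite scalerBl.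
  by rewrite -tt'; apply/eqP; rewrite eq_sym -subr_eq0 zt.
- split.
    rewrite -(osum _ (fun i => a i * v i)); apply: inj0.
    by rewrite -d0 -rhoE dd.
  move=> z za; apply/rinj/inj2; rewrite drho osum big1 // => j _.
  by rewrite -[a _]/((a \o o) j) za scale0r.
Qed.

(** * Such an algebra of finite growth has two generators *)

Section OneRelator.
Variables (k : fieldType) (T : algType k) (G : nat -> T -> Prop).
Hypothesis cg : connected_graded G.
Variable pr : nat -> T -> T.
Hypothesis prP : projections G pr.

Section Presentation.
Variables (n : nat) (v a : 'I_n -> T).
Hypothesis rel : one_relator G v a.

Lemma one_relator_ind (S : T -> Prop) : subspace S -> S 1 ->
  (forall t i, S t -> S (t * v i)) -> forall t, S t.
Proof.
move=> [S0 SD] S1 Sv.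
have SA x y : S x -> S y -> S (x + y) by move=> sx sy; rewrite -[x]scale1r; apply: SD.
have hom m t : G m t -> S t.
  elim: m t => [|m IH] t; first by move=> /(grade0E cg)[c ->]; rewrite -[_%:A]addr0; apply: SD.
  case: rel => _ _ gen _ _ /gen[c gc ->]; apply: big_ind => // i _.
  exact/Sv/IH/gc.
move=> t; have [s [_ _ ->]] := proj_sumE prP t; apply: big_ind => // i _.
exact: hom (projS prP i t).
Qed.

(** If  s z = 0  with  z = sum_i c_i v_i,  then  (c_i s)  is a syzygy, so
   c_i s = s' a_i  with  s'  of smaller degree.  For  c_i <> 0  and  j <> i  the
   element  s'  kills  c_i a_j - c_j a_i,  which is nonzero of degree one, so
   that  s' = 0  by induction on the degree. *)
Lemma degree_one_regular y s : (1 < n)%N -> G 1%N y -> y != 0 -> s * y = 0 -> s = 0.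
Proof.
move=> n1; have [[vf vs] [ga af] _ syz _] := rel.
have hom m : forall z s, G 1%N z -> z != 0 -> G m s -> s * z = 0 -> s = 0.
  elim: m => [|m IH] z s1 gz z0 gs sz.
    move: gs sz => /(grade0E cg)[c ->]; rewrite -scalerAl mul1r => /eqP.
    by rewrite scaler_eq0 (negbTE z0) orbF => /eqP ->; rewrite scale0r.
  have [c zE] := (vs z).1 gz.
  have [|s0 s0E] := syz (fun i => c i *: s1).
    rewrite -[RHS]sz zE mulr_sumr; apply: eq_bigr => i _.
    by rewrite -scalerAl -scalerAr.
  have [i ci] : exists i, c i != 0.
    apply/existsP; apply: contraNT z0; rewrite negb_exists => /forallP h.
    rewrite zE big1 // => i _; have := h i; rewrite negbK => /eqP ->.
    by rewrite scale0r.
  have [j ji] : exists j : 'I_n, j != i.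
    have [h|h] := eqVneq (i : nat) 0%N.
      by exists (Ordinal n1); rewrite -val_eqE /= h.
    by exists (Ordinal (ltn_trans (ltn0Sn 0) n1)); rewrite -val_eqE /= eq_sym.
  have gs0 : G m (pr m s0) by exact: projS prP _ _.
  have s0E' l : c l *: s1 = pr m s0 * a l.
    rewrite -(projMr cg prP (ga l)) -s0E addn1 (proj_id prP) //.
    exact: (gradeZ cg _ gs).
  have s00 : pr m s0 = 0.
    apply: (IH (c i *: a j - c j *: a i)) => //.
    - rewrite -scaleNr; apply: (gradeZD cg) => //; exact: (gradeZ cg _ (ga i)).
    - apply/eqP => h; move: ci.
      have := af (fun l => if l == j then c i else if l == i then - c j else 0) _ j.
      rewrite eqxx => -> //; first by rewrite eqxx.
      have ij : i != j by rewrite eq_sym.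
      rewrite (bigD1 j) //= eqxx (bigD1 i) //= (negbTE ij) eqxx.
      rewrite big1 ?addr0 ?scaleNr // => l /andP[/negbTE -> /negbTE ->].
      by rewrite scale0r.
    - by rewrite mulrBr -!scalerAr -!s0E' !scalerA mulrC subrr.
  have /eqP := s0E' i; rewrite s00 mul0r scaler_eq0 (negbTE ci) => /eqP.
  by [].
move=> gy y0 sy; apply: (proj_eq0 prP) => m.
apply: (hom m y) => //; first exact: projS prP _ _.
by rewrite -(projMr cg prP gy) sy (proj0 prP).
Qed.

(** A syzygy supported on two generators is  (z a_i)_i  with  z a_j = 0  for any
   third index  j,  and  a_j  is regular. *)
Lemma two_generators_free : (2 < n)%N -> exists y z : T, forall s t,
  s * y + t * z = 0 -> s = 0 /\ t = 0.
Proof.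
move=> n2; have n1 := ltnW n2; have n0 := ltnW n1.
pose i0 := Ordinal n0; pose i1 := Ordinal n1; pose i2 := Ordinal n2.
have [_ [ga af] _ syz _] := rel.
exists (v i0), (v i1) => s t h.
have [|z zE] := syz (fun i => if i == i0 then s else if i == i1 then t else 0).
  rewrite (bigD1 i0) //= (bigD1 i1) //= addrA h add0r big1 // => i.
  by move=> /andP[/negbTE -> /negbTE ->]; rewrite mul0r.
have z0 : z = 0.
  apply: (degree_one_regular n1 (ga i2)); last by rewrite -zE.
  apply/eqP => a2; have z2 : \sum_i (i == i2)%:R *: a i = 0.
    rewrite big1 // => i _; have [->|_] := eqVneq i i2; rewrite ?a2 ?scaler0 //.
    by rewrite scale0r.
  by have /eqP := af (fun i => (i == i2)%:R) z2 i2; rewrite eqxx oner_eq0.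
by split; [have := zE i0 | have := zE i1]; rewrite /= z0 mul0r.
Qed.

(** Both small cases contradict the injectivity of  P_2 -> P_1.  Without
   generators  P_1 = 0;  with a single generator  v  the relation is  v^2 = 0,
   up to a scalar, and  v  kills its coefficient. *)
Lemma relation_rank_ge2 : (1 < n)%N.
Proof.
have [[vf vs] [ga af] _ syz [rv inj]] := rel.
case En: (n) => [|[|m]] //.
  have /eqP : (1 : T) = 0.
    by apply: inj => i; have := ltn_ord i; move: (nat_of_ord i) => q; rewrite En.
  by rewrite oner_eq0.
have n0 : (0 < n)%N by rewrite En.
pose o := Ordinal n0.
have all0 i : i = o.
  by apply: val_inj => /=; have := ltn_ord i; move: (nat_of_ord i) => q; rewrite En; case: q.
have sumo (F : 'I_n -> T) : \sum_i F i = F o.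
  by rewrite (bigD1 o) //= big1 ?addr0 // => i; rewrite (all0 i) eqxx.
have [c aE] := (vs (a o)).1 (ga o); rewrite sumo in aE.
have va i : v o * a i = 0.
  move: rv; rewrite sumo (all0 i) aE -scalerAl -scalerAr => ->.
  by [].
have /vf : \sum_i (fun=> 1 : k) i *: v i = 0 by rewrite sumo (inj _ va) scaler0.
by move=> /(_ o)/eqP; rewrite oner_eq0.
Qed.

End Presentation.

Lemma exp_beats_power d n0 : exists2 n, (n0 <= n)%N & (n ^ d < 2 ^ n)%N.
Proof.
pose f := (2 * d + n0)%N; exists (2 ^ (2 * f))%N.
  apply: leq_trans (ltnW (ltn_expl (2 * f) (ltnSn 1))); rewrite /f; lia.
rewrite -expnM ltn_exp2l // mulnC expnM -!/(2 ^ _)%N.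
have h : (2 ^ (2 * f) = 2 ^ f * 2 ^ f)%N by rewrite -expnD addnn mul2n.
have := ltn_expl f (ltnSn 1); rewrite -expnM h; move: (2 ^ f)%N => q fq.
have : (2 * d <= f)%N by rewrite /f; lia.
move=> df; apply: (@leq_ltn_trans (f * f)); first nia.
by apply: ltn_mul.
Qed.

Definition seq_indep (l : seq T) := forall c : seq k, size c = size l ->
  \sum_(p <- zip c l) p.1 *: p.2 = 0 -> forall i, c`_i = 0.

Lemma indep_size_le l S m : seq_indep l -> dim_le S m -> (forall x, x \in l -> S x) ->
  (size l <= m)%N.
Proof.
move=> il [x xS] lS; rewrite leqNgt; apply/negP => lt.
have h i : exists c : 'I_m -> k, (i < size l)%N -> l`_i = \sum_j c j *: x j.
  case: (ltnP i (size l)) => [ltl|_]; last by exists (fun=> 0).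
  by have [c cE] := xS _ (lS _ (mem_nth 0 ltl)); exists c.
have [C CE] := choice h.
pose M : 'M[k]_(size l, m) := \matrix_(i, j) C i j.
have : kermx M != 0.
  rewrite kermx_eq0; apply: contraTN lt => /eqP rM; rewrite -leqNgt -rM.
  exact: rank_leq_col.
move=> /rowV0Pn[r /sub_kermxP rM /negP]; apply; apply/eqP/rowP => i; rewrite mxE.
have sz : size [seq r 0 i | i : 'I_(size l)] = size l by rewrite size_map size_enum_ord.
have := il _ sz _ i; rewrite (nth_map i) ?size_enum_ord // nth_ord_enum; apply.
rewrite (big_nth (0, 0)) size_zip sz minnn big_mkord.
under eq_bigr => j _ do rewrite nth_zip // (nth_map i) ?size_enum_ord // nth_ord_enum
  CE // scaler_sumr.
rewrite exchange_big big1 //= => j _.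
under eq_bigr => q _ do rewrite scalerA.
rewrite -scaler_suml; have /rowP/(_ j) := rM; rewrite !mxE => e.
rewrite (_ : \sum_i _ = 0) ?scale0r // -[RHS]e; apply: eq_bigr => q _.
by rewrite !mxE.
Qed.

(** The  2^m  words of length  m  in  y  and  z  are linearly independent. *)
Lemma free_pair_not_finite_GK (y z : T) :
  (forall s t, s * y + t * z = 0 -> s = 0 /\ t = 0) -> ~ finite_GKdim T.
Proof.
move=> fyz [d GK].
pose words := fix W m := if m is m'.+1 then
  [seq t * y | t <- W m'] ++ [seq t * z | t <- W m'] else [:: 1].
have szw m : size (words m) = (2 ^ m)%N.
  by elim: m => //= m IH; rewrite size_cat !size_map IH expnS mul2n addnn.
have zipm (c : seq k) (l : seq T) (b : T) :
    \sum_(p <- zip c [seq t * b | t <- l]) p.1 *: p.2 = (\sum_(p <- zip c l) p.1 *: p.2) * b.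
  elim: c l => [|c cs IH] [|t l] //=; rewrite ?big_nil ?mul0r //.
  by rewrite !big_cons /= IH mulrDl scalerAl.
have iw m : seq_indep (words m).
  elim: m => [|m IH] c.
    case: c => [|c0 [|c1 c]] //= _; rewrite big_seq1 /= => /eqP.
    by rewrite scaler_eq0 oner_eq0 orbF => /eqP -> [|[]].
  rewrite /= size_cat !size_map => sz.
  rewrite -(cat_take_drop (size (words m)) c) zip_cat; last first.
    by rewrite size_map size_takel // sz leq_addr.
  rewrite big_cat /= !zipm => /fyz[/IH h1 /IH h2] i.
  rewrite nth_cat; case: ifP => _; [apply: h1|apply: h2].
    by rewrite size_takel // sz leq_addr.
  by rewrite size_drop sz addnK.
have inw m t : t \in words m -> exists w : seq T,
    [/\ size w = m, {subset w <= [:: y; z]} & t = \prod_(x <- w) x].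
  elim: m t => [|m IH] t /=.
    by rewrite inE => /eqP ->; exists [::]; rewrite big_nil.
  rewrite mem_cat => /orP[] /mapP[t' /IH[w [sw ws ->]] ->].
    exists (rcons w y); rewrite size_rcons sw -cats1 big_cat big_seq1; split=> //.
    by move=> b; rewrite mem_cat inE => /orP[/ws //|/eqP ->]; rewrite inE eqxx.
  exists (rcons w z); rewrite size_rcons sw -cats1 big_cat big_seq1; split=> //.
  by move=> b; rewrite mem_cat inE => /orP[/ws //|/eqP ->]; rewrite !inE eqxx orbT.
have [n0 n0P] := GK [:: y; z]; have [n nn0 big] := exp_beats_power d n0.
have := indep_size_le (iw n) (n0P n nn0); rewrite szw leqNgt big => /(_ _)/negP; apply=> //.
move=> x /inw[w [sw ws ->]] S _ Sw; apply: Sw => //; by rewrite sw.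
Qed.

Theorem relation_rank_eq2 n (v a : 'I_n -> T) : one_relator G v a -> finite_GKdim T -> n = 2%N.
Proof.
move=> rel GK; apply/eqP; rewrite eqn_leq (relation_rank_ge2 rel) andbT leqNgt.
apply/negP => /(two_generators_free rel)[y [z yz]].
exact: free_pair_not_finite_GK yz GK.
Qed.

End OneRelator.

(** * Changing the generators *)

Section MatrixAction.
Variables (k : fieldType) (V : lmodType k).

Definition mxact m n (M : 'M[k]_(m, n)) (t : 'I_n -> V) : 'I_m -> V :=
  fun i => \sum_j M i j *: t j.

Lemma mxact1 n (t : 'I_n -> V) i : mxact 1%:M t i = t i.
Proof.
rewrite /mxact (bigD1 i) //= mxE eqxx scale1r big1 ?addr0 // => j /negbTE ji.
by rewrite mxE eq_sym ji scale0r.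
Qed.

Lemma mxactM m n q (M : 'M[k]_(m, n)) (N : 'M[k]_(n, q)) t i :
  mxact (M *m N) t i = mxact M (mxact N t) i.
Proof.
rewrite /mxact; under [RHS]eq_bigr do rewrite scaler_sumr.
rewrite exchange_big; apply: eq_bigr => j _; rewrite mxE scaler_suml.
by apply: eq_bigr => l _; rewrite scalerA.
Qed.

Lemma eq_mxact m n (M : 'M[k]_(m, n)) t t' : t =1 t' -> mxact M t =1 mxact M t'.
Proof. by move=> e i; apply: eq_bigr => j _; rewrite e. Qed.

Lemma free_mxact_inj m n (M N : 'M[k]_(m, n)) (t : 'I_n -> V) :
  (forall c : 'I_n -> k, \sum_j c j *: t j = 0 -> forall j, c j = 0) ->
  mxact M t =1 mxact N t -> M = N.
Proof.
move=> ft e; apply/matrixP => i j; apply/eqP; rewrite -subr_eq0; apply/eqP.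
apply: (ft (fun j => M i j - N i j)).
under eq_bigr do rewrite scalerBl.
by rewrite sumrB; apply/eqP; rewrite subr_eq0; apply/eqP; exact: e.
Qed.

Lemma mxact_combine m n (M : 'M[k]_(m, n)) (t : 'I_n -> V) (c : 'I_m -> k) :
  \sum_i c i *: mxact M t i = mxact ((\row_i c i) *m M) t 0.
Proof. by rewrite mxactM; apply: eq_bigr => i _; rewrite mxE. Qed.

End MatrixAction.

Lemma mxact_dot (k : fieldType) (T : algType k) m n (M : 'M[k]_(m, n))
    (s : 'I_m -> T) (t : 'I_n -> T) :
  \sum_i s i * mxact M t i = \sum_j mxact M^T s j * t j.
Proof.
under eq_bigr do rewrite mulr_sumr; rewrite exchange_big; apply: eq_bigr => j _.
by rewrite mulr_suml; apply: eq_bigr => i _; rewrite mxE -scalerAl -scalerAr.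
Qed.

Lemma basis_change_mx (k : fieldType) (V : lmodType k) (S : V -> Prop) n (v x : 'I_n -> V) :
  Defs.basis_of S v -> Defs.basis_of S x ->
  exists C D : 'M[k]_n, [/\ v =1 mxact C x, x =1 mxact D v & C *m D = 1%:M].
Proof.
have inS (y : 'I_n -> V) j : Defs.basis_of S y -> S (y j).
  move=> [_ h]; apply/h; exists (fun i => (1%:M : 'M[k]_n) j i); symmetry; exact: mxact1.
move=> bv bx.
have h (y z : 'I_n -> V) : Defs.basis_of S y -> Defs.basis_of S z ->
    exists C : 'M[k]_n, y =1 mxact C z.
  move=> byy bz.
  have [|c cE] := @choice_ex _ _ (fun i (c : 'I_n -> k) => y i = \sum_j c j *: z j).
    by move=> i; apply/bz.2; apply: inS.
  by exists (\matrix_(i, j) c i j) => i; rewrite cE; apply: eq_bigr => j _; rewrite mxE.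
have [C vC] := h v x bv bx; have [D xD] := h x v bx bv.
exists C, D; split=> //; apply: (free_mxact_inj bv.1) => i.
by rewrite mxact1 mxactM vC; apply: eq_mxact => j; rewrite xD.
Qed.

Lemma basis_of_free2 (k : fieldType) (V : lmodType k) (S : V -> Prop) n (v x : 'I_n -> V) :
  Defs.basis_of S v -> (forall j, S (x j)) ->
  (forall c : 'I_n -> k, \sum_j c j *: x j = 0 -> forall j, c j = 0) ->
  Defs.basis_of S x.
Proof.
move=> bv Sx fx.
have [|d dE] := @choice_ex _ _ (fun i (c : 'I_n -> k) => x i = \sum_j c j *: v j).
  by move=> i; apply/bv.2.
pose D : 'M[k]_n := \matrix_(i, j) d i j.
have xD : x =1 mxact D v by move=> i; rewrite dE; apply: eq_bigr => j _; rewrite mxE.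
have uD : D \in unitmx.
  rewrite -row_free_unit -kermx_eq0; apply/rowV0P => r /sub_kermxP rD.
  apply/rowP => j; rewrite mxE; apply: (fx (fun j => r 0 j)).
  transitivity (mxact (r *m D) v 0); last first.
    by rewrite rD /mxact big1 // => i _; rewrite mxE scale0r.
  by rewrite mxactM; apply: eq_bigr => i _; rewrite xD.
have vx : v =1 mxact (invmx D) x.
  by move=> i; rewrite -[LHS]mxact1 -(mulVmx uD) mxactM; apply: eq_mxact => j; rewrite xD.
split=> // t; split=> [/(bv.2)[c ->]|[c ->]].
  exists (fun j => ((\row_i c i) *m invmx D) 0 j).
  under eq_bigr do rewrite vx.
  by rewrite mxact_combine.
apply/(bv.2); exists (fun j => ((\row_i c i) *m D) 0 j).
by under eq_bigr do rewrite xD; rewrite mxact_combine.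
Qed.

(** If  v = C x  then  sum_i a_i v_i = sum_j (C^T a)_j x_j,  and  C  is
   invertible. *)
Lemma one_relator_change_basis (k : fieldType) (T : algType k) (G : nat -> T -> Prop)
    (cg : connected_graded G) n (v a x : 'I_n -> T) :
  one_relator G v a -> Defs.basis_of (G 1%N) x -> exists a', one_relator G x a'.
Proof.
move=> [bv [ga af] gen syz [ra inj]] bx.
have [C [D [vC xD CD]]] := basis_change_mx bv bx.
have DC := mulmx1C CD.
exists (mxact C^T a); split=> //.
- split=> [j|c].
    by apply: (grade_sum cg) => i _; apply: (gradeZ cg).
  rewrite mxact_combine => /af h.
  have z : (\row_i c i) *m C^T = 0 by apply/rowP => j; rewrite h mxE.
  have z' : \row_i c i = 0 by rewrite -[LHS]mulmx1 -trmx1 -DC trmx_mul mulmxA z mul0mx.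
  by move=> j; have /rowP/(_ j) := z'; rewrite !mxE.
- move=> m t /gen[c gc ->]; exists (mxact C^T c).
    by move=> i; apply: (grade_sum cg) => j _; apply: (gradeZ cg).
  by rewrite -mxact_dot; apply: eq_bigr => i _; rewrite vC.
- move=> t tx; have [|s sE] := syz (mxact D^T t).
    by rewrite -mxact_dot -[RHS]tx; apply: eq_bigr => i _; rewrite xD.
  exists s => i; rewrite -[LHS]mxact1 -trmx1 -DC trmx_mul mxactM (eq_mxact _ sE).
  by rewrite /mxact mulr_sumr; apply: eq_bigr => j _; rewrite scalerAr.
- split.
    by rewrite -mxact_dot -[RHS]ra; apply: eq_bigr => i _; rewrite vC.
  move=> s h; apply: inj => i; rewrite -[a i]mxact1 -trmx1 -CD trmx_mul mxactM.
  rewrite [mxact _ _ _]/mxact mulr_sumr big1 // => j _.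
  by rewrite -scalerAr h scaler0.
Qed.

(** * Polynomial algebras in two variables *)

Lemma sum_ord2 (M : zmodType) (F : 'I_2 -> M) : \sum_i F i = F ord0 + F ord_max.
Proof. by rewrite big_ord_recl big_ord1; congr (_ + F _); apply: val_inj. Qed.

Lemma ord2_ind (P : 'I_2 -> Prop) : P ord0 -> P ord_max -> forall i, P i.
Proof.
move=> h0 h1 [[|[|m]] lt] //; first by have <- : ord0 = Ordinal lt by apply: val_inj.
by have <- : ord_max = Ordinal lt by apply: val_inj.
Qed.

Section Plane.
Variables (k : fieldType) (T : algType k) (G : nat -> T -> Prop).
Hypothesis cg : connected_graded G.
Variables (x a : 'I_2 -> T).
Hypothesis rel : one_relator G x a.
Let x0 := x ord0.
Let x1 := x ord_max.
Hypothesis xC : x0 * x1 = x1 * x0.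

Let gx i : G 1%N (x i).
Proof.
case: rel => -[_ h] _ _ _ _; apply/h; exists (fun j => (1%:M : 'M[k]_2) i j).
by symmetry; exact: mxact1.
Qed.

Lemma plane_comm (s t : T) : s * t = t * s.
Proof.
have xt i s1 : x i * s1 = s1 * x i.
  have [pr prP] := graded_proj cg.
  apply: (one_relator_ind cg prP rel (S := fun s => x i * s = s * x i)).
  - split; first by rewrite mulr0 mul0r.
    by move=> c y z hy hz; rewrite mulrDr mulrDl -scalerAr -scalerAl hy hz.
  - by rewrite mulr1 mul1r.
  - move=> t1 j h; rewrite mulrA h -!mulrA; congr (_ * _).
    move: i j {h}; apply: ord2_ind; apply: ord2_ind => //.
have [pr prP] := graded_proj cg.
apply: (one_relator_ind cg prP rel (S := fun t => s * t = t * s)) t.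
- split; first by rewrite mulr0 mul0r.
  by move=> c y z hy hz; rewrite mulrDr mulrDl -scalerAr -scalerAl hy hz.
- by rewrite mulr1 mul1r.
- by move=> t1 j h; rewrite mulrA h -!mulrA xt.
Qed.

Hypothesis syz : forall s t, s * x0 + t * x1 = 0 -> exists z, s = z * x1.

Definition monomial (e : nat * nat) : T := x0 ^+ e.1 * x1 ^+ e.2.

Lemma monomial_spanning : spanning monomial.
Proof.
have [pr prP] := graded_proj cg => t.
apply: (one_relator_ind cg prP rel (S := fun t =>
  exists (s : seq (nat * nat)) c, t = \sum_(i <- s) c i *: monomial i)) t.
- split; first by exists [::], (fun=> 0); rewrite big_nil.
  move=> c _ _ [s [d ->]] [s' [d' ->]].
  exists (undup (s ++ s')), (fun i => c * (d i *+ count_mem i s) + d' i *+ count_mem i s').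
  have h (s1 : seq (nat * nat)) d1 : {subset s1 <= s ++ s'} ->
     \sum_(i <- s1) d1 i *: monomial i =
     \sum_(i <- undup (s ++ s')) (d1 i *+ count_mem i s1) *: monomial i.
    move=> sub; rewrite -big_undup_iterop_count.
    under eq_bigr => i do
      rewrite -[iterop _ _ _ _]/(d1 i *: monomial i *+ count_mem i s1) scalerMnl.
    apply: eq_big_support; rewrite ?undup_uniq // => i; first by rewrite !mem_undup => /sub.
    by rewrite mem_undup => /count_memPn ->; rewrite mulr0n scale0r.
  rewrite (h s d) => [|i]; last by rewrite mem_cat => ->.
  rewrite (h s' d') => [|i]; last by rewrite mem_cat orbC => ->.
  rewrite scaler_sumr -big_split; apply: eq_bigr => i _ /=.
  by rewrite scalerDl scalerA.
- by exists [:: (0, 0)]%N, (fun=> 1); rewrite big_seq1 scale1r /monomial mulr1.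
- move=> t i [s [c ->]]; move: i; apply: ord2_ind.
    exists [seq (e.1.+1, e.2) | e <- s], (fun e => c (e.1.-1, e.2)).
    rewrite big_map mulr_suml; apply: eq_bigr => -[a1 a2] _ /=.
    rewrite -scalerAl -mulrA [x1 ^+ _ * _]plane_comm mulrA -exprSr.
    by [].
  exists [seq (e.1, e.2.+1) | e <- s], (fun e => c (e.1, e.2.-1)).
  rewrite big_map mulr_suml; apply: eq_bigr => -[a1 a2] _ /=.
  by rewrite -scalerAl -mulrA -exprSr.
Qed.

(** No nonzero polynomial in  x0  is a multiple of  x1:  its constant term
   vanishes for degree reasons, and then the syzygies of  (x0, x1)  exhibit the
   quotient by  x0  as a multiple of  x1  again. *)
Lemma horner_x0_eq0 (q : {poly k}) t : horner_alg x0 q = t * x1 -> q = 0.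
Proof.
have [pr prP] := graded_proj cg.
elim/poly_ind: q t => [//|q c IH] t.
rewrite rmorphD rmorphM /= horner_algX horner_algC => h.
have c0 : c = 0.
  have := congr1 (pr 0%N) h.
  rewrite (projD prP) !(projMr_lt cg prP (gx _)) // add0r.
  rewrite (proj_id prP) ?(grade0E cg); last by exists c.
  by move/eqP; rewrite scaler_eq0 oner_eq0 orbF => /eqP.
move: h; rewrite c0 scale0r addr0 => h.
have [|z zE] := @syz (horner_alg x0 q) (- t); first by rewrite h mulNr subrr.
by rewrite (IH _ zE) mul0r addr0.
Qed.

(** Induction on the degree in  x1,  whose regularity allows cancelling it once
   the constant coefficient is known to vanish. *)
Lemma horner2_eq0 (P : {poly {poly k}}) :
  (map_poly (horner_alg x0) P).[x1] = 0 -> P = 0.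
Proof.
have [pr prP] := graded_proj cg.
elim/poly_ind: P => [//|P c IH].
rewrite rmorphD rmorphM /= map_polyX map_polyC hornerMXaddC => h.
have c0 : c = 0.
  apply: (@horner_x0_eq0 c (- (map_poly (horner_alg x0) P).[x1])).
  by rewrite mulNr; apply/eqP; rewrite -addr_eq0 addrC h.
rewrite {}c0 raddf0 addr0 in h *; rewrite polyC0 addr0 IH ?mul0r //.
apply: (degree_one_regular cg prP rel isT (gx ord_max) _ h).
apply/eqP => e; case: rel => -[f _] _ _ _ _.
have := f (fun i => (i == ord_max)%:R) _ ord_max; rewrite sum_ord2 /= scale0r add0r e scaler0.
by move=> /(_ erefl)/eqP; rewrite oner_eq0.
Qed.

Lemma monomial_free : free_family monomial.
Proof.
move=> s c us h e es.
pose P : {poly {poly k}} := \sum_(i <- s) (c i *: 'X^(i.1)) *: 'X^(i.2).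
have /horner2_eq0 P0 : (map_poly (horner_alg x0) P).[x1] = 0.
  rewrite raddf_sum horner_sum -[RHS]h; apply: eq_bigr => i _.
  rewrite /= map_polyZ map_polyXn hornerZ hornerXn -mul_polyC rmorphM rmorphXn /=.
  by rewrite horner_algC horner_algX -!scalerAl mul1r.
have := congr1 (fun Q : {poly {poly k}} => Q`_e.2`_e.1) P0.
rewrite /P coef_sum coef_sum !coef0 (bigD1_seq e) //= big1 => [|i ie].
  by rewrite coefZ coefXn eqxx mulr1 coefZ coefXn eqxx mulr1 addr0.
rewrite coefZ coefXn; have [e2|_] := eqVneq e.2 i.2; last by rewrite mulr0 coef0.
rewrite mulr1 coefZ coefXn; have [e1|_] := eqVneq e.1 i.1; last by rewrite mulr0.
by move: ie; rewrite [i]surjective_pairing [e]surjective_pairing e1 e2 eqxx.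
Qed.

Lemma plane_polynomial_ring : polynomial_ring_on (G 1%N).
Proof.
pose f : {mpoly k[2]} -> T := mmap (in_alg T) x.
have fM : monoid_morphism f.
  case: (@commr_mmap_is_multiplicative 2 k T x (in_alg T)) => [i c|p m1 m2|h1 h2].
  - exact: plane_comm.
  - exact: plane_comm.
  by split.
have fD : zmod_morphism f by exact: mmap_is_additive.
have fZ : scalable f by move=> c q; rewrite /f mmapZ /= -scalerAl mul1r.
pose g : {lrmorphism {mpoly k[2]} -> T} := HB.pack f
  (GRing.isZmodMorphism.Build _ _ f fD) (GRing.isMonoidMorphism.Build _ _ f fM)
  (GRing.isScalable.Build _ _ _ _ f fZ).
have fE q : f q = \sum_(m <- msupp q) q@_m *: monomial (m ord0, m ord_max).
  rewrite /f /mmap; apply: eq_bigr => m _ /=.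
  rewrite -scalerAl mul1r /mmap1 /monomial /= big_ord_recl big_ord1.
  by congr (_ *: (_ * x _ ^+ m _)); apply: val_inj.
pose mm (e : nat * nat) : 'X_{1..2} := [multinom if i == ord0 then e.1 else e.2 | i < 2].
have mmK (m : 'X_{1..2}) : mm (m ord0, m ord_max) = m.
  by apply/mnmP; apply: ord2_ind; rewrite mnmE.
have mm0 e : (mm e ord0, mm e ord_max) = e.
  by rewrite !mnmE /= -surjective_pairing.
exists 2%N, x, g; split; first by case: rel.
  by move=> j; rewrite -[g _]/(f _) /f mmapX mmap1U.
have finj : injective g.
  apply: raddf_inj => q; move=> q0; have {}q0 : f q = 0 := q0; rewrite fE in q0.
  apply/mpolyP => m; rewrite mcoeff0; apply/eqP; rewrite mcoeff_eq0; apply/negP => mq.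
  have := monomial_free (s := [seq (m ord0, m ord_max) | m : 'X_{1..2} <- msupp q])
    (c := fun e => q@_(mm e)).
  rewrite map_inj_uniq ?msupp_uniq => [/(_ isT)|m1 m2 e]; last by rewrite -(mmK m1) e mmK.
  rewrite big_map; under eq_bigr do rewrite mmK.
  move=> /(_ q0 _ (map_f _ mq)); rewrite mmK => /eqP.
  by rewrite mcoeff_eq0 mq.
have [h hK] : exists h : T -> {mpoly k[2]}, forall t, g (h t) = t.
  apply: (choice_ex (P := fun t q => g q = t)) => t; have [s [c ->]] := monomial_spanning t.
  exists (\sum_(e <- s) c e *: 'X_[mm e]); rewrite linear_sum; apply: eq_bigr => e _.
  rewrite linearZ; congr (_ *: _).
  by rewrite -[LHS]/(f _) fE msuppX big_seq1 mcoeffX eqxx scale1r mm0.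
by exists h => [q|t]; [apply: finj; rewrite hK | exact: hK].
Qed.

End Plane.

(** * The Hopf algebra U *)

Section SubalgebraType.
Variables (k : fieldType) (A : algType k) (S : A -> Prop) (subS : subalgebra S).

Definition subalgebra_pred (_ : subalgebra S) : {pred A} := fun x => `[< S x >].

Lemma subalgebra_pred_closed : subalg_closed (subalgebra_pred subS).
Proof.
have [[S0 SD] S1 SM] := subS; split; first exact/asboolP.
  by move=> c x y /asboolP sx /asboolP sy; apply/asboolP/SD.
by move=> x y /asboolP sx /asboolP sy; apply/asboolP/SM.
Qed.

HB.instance Definition _ := GRing.isSubalgClosed.Build k A (subalgebra_pred subS)
  subalgebra_pred_closed.

Record subalgebra_type :=
  Subalgebra { subalgebra_val : A; _ : subalgebra_val \in subalgebra_pred subS }.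

HB.instance Definition _ := [isSub of subalgebra_type for subalgebra_val].
HB.instance Definition _ := [Choice of subalgebra_type by <:].
HB.instance Definition _ := [SubChoice_isSubAlgebra of subalgebra_type by <:].

End SubalgebraType.

Section HopfU.
Variables (k : fieldType) (p : nat) (U : hopfAlgebra k) (u w : U).
Hypothesis hU : is_U p u w.

(** The presentation maps  U  to the subalgebra, and the uniqueness clause says
   that the composite with the inclusion is the identity. *)
Lemma U_generated (S : U -> Prop) : subalgebra S -> S u -> S w -> forall h, S h.
Proof.
move=> subS Su Sw h; case: (hU) => [[up wp wu] univ _ _].
have um : u \in subalgebra_pred subS by apply/asboolP.
have wm : w \in subalgebra_pred subS by apply/asboolP.
pose u' : subalgebra_type subS := Subalgebra um.
pose w' : subalgebra_type subS := Subalgebra wm.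
have [|f [fu fw _]] := univ (subalgebra_type subS) u' w'.
  split; apply: val_inj; rewrite ?rmorphXn ?rmorphB ?rmorphM //=.
have [g [_ _ gE]] := univ U u w (And3 up wp wu).
pose F (x : U) : U := val (f x).
have FB : zmod_morphism F by move=> x y; rewrite /F !rmorphB.
have FM : monoid_morphism F by split=> [|x y]; rewrite /F ?rmorph1 ?rmorphM.
have FZ : scalable F by move=> c x; rewrite /F !linearZ.
pose vf : {lrmorphism U -> U} := HB.pack F (GRing.isZmodMorphism.Build _ _ F FB)
  (GRing.isMonoidMorphism.Build _ _ F FM) (GRing.isScalable.Build _ _ _ _ F FZ).
have vfE : vf =1 g by apply: gE; rewrite /= /F ?fu ?fw.
have idg : idfun =1 g by exact: (gE (idfun : {lrmorphism U -> U})).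
rewrite -[h]/(idfun h) idg -vfE /=.
by have /asboolP := valP (f h).
Qed.

(** The matrix units  e_21  and  e_22  satisfy the relations of  u  and  w. *)
Lemma U_u_neq0 : (1 < p)%N -> u != 0.
Proof.
move=> p1; case: hU => _ univ _ _; apply/eqP => u0.
pose a : 'M[k]_2 := delta_mx ord_max ord0; pose b : 'M[k]_2 := delta_mx ord_max ord_max.
have aa : a * a = 0 by rewrite /a -[LHS]/(_ *m _) mul_delta_mx_0.
have bb : b * b = b by rewrite /b -[LHS]/(_ *m _) mul_delta_mx.
have [|f [fu _ _]] := univ 'M[k]_2 a b.
  split.
  - by case: (p) p1 => [|[|q]] // _; rewrite !exprS mulrA aa mul0r.
  - case: (p) p1 => [|q] // _; elim: q => [|q IH]; first by rewrite expr1.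
    by rewrite exprS IH bb.
  - rewrite -[b * a]/(_ *m _) -[a * b]/(_ *m _) /a /b mul_delta_mx.
    by rewrite mul_delta_mx_0 ?subr0.
move: fu; rewrite u0 linear0 => /matrixP/(_ ord_max ord0)/eqP.
by rewrite !mxE !eqxx eq_sym oner_eq0.
Qed.

(** In Sweedler notation  S(a_1 h) a_2 + S(a_1) a_2 h = eps(a h) = 0,  so that
   S(a_1 h) a_2 = - eps(a) h;  multiply by  S(a_3)  on the right. *)
Lemma antipode_mul_primitive (h a : U) : primitive h ->
  antipode (a * h) = - (h * antipode a).
Proof.
move=> [ch eh _].
have lS : linear (@antipode k U) by move=> c x y; exact: antipode_linear.
have [S SE] := linear_bundle lS.
have left (b : U) : \sum_(x <- comul b) S (x.1 * h) * x.2 = - (counit b *: h).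
  have bil : bilinear_map (fun y1 y2 : U => S y1 * y2).
    split=> [y1|y2] c x y; first by rewrite mulrDr scalerAr.
    by rewrite linearP mulrDl scalerAl.
  have := antipode_left (b * h).
  rewrite counit_mul eh mulr0 scale0r.
  under eq_bigr do rewrite -SE.
  rewrite (comul_mul b h bil) big_allpairs_dep /=.
  have inner (x : U * U) : \sum_(y <- comul h) S (x.1 * y.1) * (x.2 * y.2) =
     S (x.1 * h) * x.2 + S x.1 * x.2 * h.
    rewrite (ch _ (fun y1 y2 => S (x.1 * y1) * (x.2 * y2))).
      by rewrite big_cons big_seq1 /= !mulr1 mulrA.
    split=> [y1|y2] c y z.
      by rewrite !mulrDr -!scalerAr.
    by rewrite mulrDr linearD mulrDl -scalerAr linearZ /= scalerAl.
  under eq_bigr do rewrite inner.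
  rewrite big_split /= -mulr_suml => /eqP; rewrite addr_eq0 => /eqP ->.
  have := antipode_left b; under eq_bigr do rewrite -SE; move=> ->.
  by rewrite -scalerAl mul1r.
have tri : trilinear_map (fun x y z : U => S (x * h) * y * S z).
  split=> [x y|x z|y z] c a1 a2.
  - by rewrite linearP mulrDr scalerAr.
  - by rewrite mulrDr mulrDl -scalerAr -scalerAl.
  - by rewrite mulrDl linearD -scalerAl linearZ !mulrDl -!scalerAl.
have right (x1 x2 : U) :
    \sum_(y <- comul x2) S (x1 * h) * y.1 * S y.2 = counit x2 *: S (x1 * h).
  transitivity (S (x1 * h) * \sum_(y <- comul x2) y.1 * antipode y.2).
    by rewrite mulr_sumr; apply: eq_bigr => y _; rewrite mulrA (SE y.2).
  by rewrite antipode_right -scalerAr mulr1.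
have left2 (x1 x2 : U) :
    \sum_(y <- comul x1) S (y.1 * h) * y.2 * S x2 = - (h * S (counit x1 *: x2)).
  by rewrite -mulr_suml left mulNr -scalerAl [S (_ *: _)]linearZ /= scalerAr.
have := comul_coassoc a tri.
under eq_bigr => x _ do rewrite left2.
under [in RHS]eq_bigr => x _ do rewrite right.
rewrite sumrN -mulr_sumr -linear_sum counit_left SE => ->.
rewrite -SE -{1}(counit_right a) mulr_suml linear_sum; apply: eq_bigr => x _.
by rewrite -scalerAl [S (_ *: _)]linearZ.
Qed.

(** U u  is two-sided because  u w = (w - 1) u,  and the coalgebra structure and
   the antipode preserve it because  u  is primitive. *)
Lemma Uu_hopf_ideal : hopf_ideal (fun h : U => exists a, h = a * u).
Proof.
case: (hU) => [[_ _ wu] _ pu _]; have [cu eu _] := pu.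
have ub b : exists a, u * b = a * u.
  move: b; apply: U_generated.
  - split; last 2 [by exists 1; rewrite mulr1 mul1r].
    + split; first by exists 0; rewrite mulr0 mul0r.
      move=> c x y [a ax] [b by_]; exists (c *: a + b).
      by rewrite mulrDr mulrDl -scalerAr ax by_ scalerAl.
    + move=> x y [a ax] [b by_]; exists (a * b).
      by rewrite mulrA ax -mulrA by_ mulrA.
  - by exists u.
  - exists (w - 1); rewrite mulrBl mul1r -[X in _ = _ - X]wu.
    by rewrite opprB addrC subrK.
split.
- split; first by exists 0; rewrite mul0r.
  by move=> c _ _ [a ->] [b ->]; exists (c *: a + b); rewrite mulrDl scalerAl.
- move=> a _ b [x ->]; have [y yE] := ub b; exists (a * x * y).
  by rewrite -!mulrA yE.
- move=> _ [a ->].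
  exists [seq (x.1 * y.1, x.2 * y.2) | x <- comul a, y <- [:: (u, 1); (1, u)]].
    move=> W f bf; rewrite (comul_mul a u bf) !big_allpairs_dep; apply: eq_bigr => x _ /=.
    have [f1 f2] := bf.
    rewrite (cu _ (fun y1 y2 => f (x.1 * y1) (x.2 * y2))) //.
    split=> [y1|y2] c y z.
      by rewrite mulrDr -scalerAr f1.
    by rewrite mulrDr -scalerAr f2.
  move=> _ /allpairsP[[x y] [_ ye ->]] /=.
  rewrite /= !inE in ye; case/orP: ye => /eqP -> /=; [left|right].
    by exists x.1.
  by exists x.2.
- by move=> _ [a ->]; rewrite counit_mul eu mulr0.
- move=> _ [a ->]; rewrite antipode_mul_primitive //.
  by have [b ->] := ub (antipode a); exists (- b); rewrite mulNr.
Qed.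

Section Action.
Variables (T : algType k) (act : U -> T -> T).
Hypothesis hact : hopf_action act.

Let hmod : hopf_module act. Proof. by case: hact. Qed.

Lemma act_linear h : linear (act h). Proof. by case: hmod. Qed.
Lemma actD h x y : act h (x + y) = act h x + act h y.
Proof. by have := act_linear h 1 x y; rewrite !scale1r. Qed.
Lemma act0 h : act h 0 = 0.
Proof. by apply: (@addrI _ (act h 0)); rewrite -actD !addr0. Qed.
Lemma actZ h c x : act h (c *: x) = c *: act h x.
Proof. by have := act_linear h c x 0; rewrite act0 !addr0. Qed.
Lemma act_sum h (J : Type) (s : seq J) (f : J -> T) :
  act h (\sum_(j <- s) f j) = \sum_(j <- s) act h (f j).
Proof. by elim/big_rec2: _ => [|j y1 y2 _ <-]; rewrite ?act0 ?actD. Qed.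
Lemma actM g h x : act (g * h) x = act g (act h x). Proof. by case: hmod. Qed.
Lemma actX h m x : act (h ^+ m) x = iter m (act h) x.
Proof.
by elim: m => [|m IH]; [case: hmod => _ _ -> | rewrite exprS actM IH].
Qed.

Lemma act_derivation h : primitive h -> forall x y, act h (x * y) = act h x * y + x * act h y.
Proof.
move=> [ch _ _] x y; case: hact => -[al hl a1 _] -> _.
rewrite (ch _ (fun g1 g2 => act g1 x * act g2 y)).
  by rewrite big_cons big_seq1 /= !a1.
split=> [g|g] c g1 g2.
  by rewrite hl mulrDr -scalerAr.
by rewrite hl mulrDl -scalerAl.
Qed.

Lemma act_primitive1 h : primitive h -> act h 1 = 0.
Proof. by move=> [_ eh _]; case: hact => _ _ ->; rewrite eh scale0r. Qed.

(** The operators that act on  a  through the counit form a subalgebra. *)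
Lemma fixedP a : fixed act a <-> act u a = 0 /\ act w a = 0.
Proof.
case: (hU) => _ _ [_ eu _] [_ ew _].
split=> [fa|[ua wa]]; first by rewrite !fa eu ew scale0r.
apply: U_generated; last 2 first.
- by rewrite ua eu scale0r.
- by rewrite wa ew scale0r.
case: hmod => _ hl a1 _; split.
- split; last by move=> c g h ga ha; rewrite hl ga ha counit_linear scalerDl scalerA.
  have -> : counit (0 : U) = 0.
    by have := counit_linear (-1) (0 : U) 0; rewrite scaler0 addr0 mulN1r addNr.
  by have := hl a (-1) 0 0; rewrite scaler0 addr0 scaleN1r addNr scale0r.
- by rewrite a1 counit_one scale1r.
- by move=> g h ga ha; rewrite actM ha actZ ga counit_mul scalerA mulrC.
Qed.

End Action.
End HopfU.

(** * Actions of U on an algebra with one relation *)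

(** The elements of the prime field exhaust the roots of  X^p - X. *)
Lemma frobenius_fixed (k : fieldType) p (al : k) : p \in [pchar k] -> al ^+ p = al ->
  exists2 i, (i <= p.-1)%N & al = i%:R.
Proof.
move=> hp alp; have pp := pcharf_prime hp; have p1 := prime_gt1 pp.
pose q : {poly k} := 'X^p - 'X.
have szq : size q = p.+1.
  by rewrite /q size_polyDl ?size_polyXn // size_polyN size_polyX.
pose s : seq k := [seq i%:R | i <- iota 0 p].
have [/mapP[i]|als] := boolP (al \in s).
  by rewrite mem_iota => /andP[_ ip] ->; exists i => //; rewrite -ltnS prednK // ltnW.
have q0 : q != 0 by rewrite -size_poly_eq0 szq.
have rootq x : root q x = (x ^+ p == x) by rewrite /root !hornerE subr_eq0.
have us : uniq s.
  rewrite map_inj_in_uniq ?iota_uniq // => i j; rewrite !mem_iota /= !add0n => ip jp.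
  wlog ij : i j ip jp / (i <= j)%N => [H e|].
    by have [/H|/ltnW/H] := leqP i j; [exact|move=> h; symmetry; exact: h].
  move/esym/eqP; rewrite -subr_eq0 -natrB // -(dvdn_pcharf hp).
  have [->|ji] := eqVneq i j => //.
  by rewrite gtnNdvd //; lia.
have rs : all (root q) (al :: s).
  apply/allP => x; rewrite inE rootq => /orP[/eqP ->|/mapP[i _ ->]]; first by rewrite alp.
  by rewrite -(pFrobenius_autE hp) pFrobenius_aut_nat.
have := max_poly_roots q0 rs; rewrite /= als us => /(_ isT).
by rewrite size_map size_iota szq ltnn.
Qed.

Section Quotients.
Variables (k : fieldType) (p : nat) (hp : p \in [pchar k]).
Variables (U : hopfAlgebra k) (u w : U).
Hypothesis hU : is_U p u w.
Variables (T : algType k) (G : nat -> T -> Prop).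
Hypothesis cg : connected_graded G.
Variable act : U -> T -> T.
Hypothesis hact : hopf_action act.
Hypothesis hhom : homogeneous_action act G.
Variables (v0 a0 : 'I_2 -> T).
Hypothesis rel0 : one_relator G v0 a0.

Let pp := pcharf_prime hp.
Let pu : primitive u. Proof. by case: hU. Qed.
Let pw : primitive w. Proof. by case: hU. Qed.
Let up0 : u ^+ p = 0. Proof. by case: hU => -[]. Qed.
Let wp : w ^+ p = w. Proof. by case: hU => -[]. Qed.
Let wu t : act w (act u t) = act u (act w t) + act u t.
Proof.
case: hU => -[_ _ e] _ _ _; case: hact => -[_ hl _ _] _ _.
have := hl t (-1) (u * w) (w * u); rewrite scaleN1r addrC e => h; rewrite [X in _ = _ + X]h.
by rewrite scaleN1r !(actM hact) addrA subrr add0r.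
Qed.
Let gact h n t : G n t -> G n (act h t).
Proof. by case: (hhom n) => _ /(_ h t). Qed.

(** Otherwise the derivation  u  vanishes on  T,  which is generated in degree
   one, and the Hopf ideal  U u  acts by zero. *)
Lemma u_acts_nonzero : inner_faithful act -> exists2 t, G 1%N t & act u t != 0.
Proof.
move=> faith; have [h|h] := pselect (exists2 t, G 1%N t & act u t != 0); first exact: h.
case: faith; exists (fun h : U => exists a, h = a * u); split.
- exact: Uu_hopf_ideal hU.
- exists u; first by exists 1; rewrite mul1r.
  exact: U_u_neq0 hU (prime_gt1 pp).
- move=> _ t [b ->]; rewrite (actM hact).
  suff -> : act u t = 0 by rewrite (act0 hact).
  have [pr prP] := graded_proj cg.
  apply: (one_relator_ind cg prP rel0 (S := fun t => act u t = 0)) t.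
  + split; first exact: act0 hact _.
    by move=> c x y hx hy; rewrite (actD hact) (actZ hact) hx hy scaler0 addr0.
  + by rewrite (act_primitive1 hact pu).
  + move=> t i ut; rewrite (act_derivation hact pu) ut mul0r add0r.
    have [->|nz] := eqVneq (act u (v0 i)) 0; first by rewrite mulr0.
    case: h; exists (v0 i) => //; case: rel0 => -[_ vs] _ _ _ _; apply/vs.
    by exists (fun j => (1%:M : 'M[k]_2) i j); symmetry; exact: mxact1.
Qed.

(** As  u  is nilpotent and nonzero on  V,  there is  y  with  u y <> 0  and
   u^2 y = 0.  If  w y = al y + be u y,  then  y' = y - be u y  satisfies
   w y' = al y'  and  u y' = u y,  on which  w  acts by  al + 1.  Finally
   w^p = w  places  al  in the prime field. *)
Lemma exists_standard_basis : inner_faithful act ->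
  exists (i : nat) (x : 'I_2 -> T), (i <= p.-1)%N /\ standard_basis u w act (G 1%N) i x.
Proof.
move=> /u_acts_nonzero[t gt ut].
have itg n : G 1%N (iter n (act u) t) by elim: n => //= n; exact: gact.
have nil : exists n, iter n (act u) t == 0.
  by exists p; rewrite -(actX hact) up0; case: hact => -[_ hl _ _] _ _;
    have := hl t (-1) 0 0; rewrite scaler0 addr0 scaleN1r addNr => ->.
have [m /eqP m0 mmin] := ex_minnP nil.
have [y gy [uy uuy]] : exists2 y, G 1%N y & act u y != 0 /\ act u (act u y) = 0.
  case: m m0 mmin => [|[|m]] /= m0 mmin.
  - by rewrite m0 (act0 hact) eqxx in ut.
  - by rewrite m0 eqxx in ut.
  - exists (iter m (act u) t) => //; split=> //; apply/negP => /(mmin m.+1).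
    by rewrite ltnn.
have indep (y' : T) (c d : k) : act u y' = act u y -> c *: y' + d *: act u y = 0 -> c = 0 /\ d = 0.
  move=> uy' e; have c0 : c = 0.
    have := congr1 (act u) e; rewrite (actD hact) !(actZ hact) uuy scaler0 addr0 (act0 hact) uy'.
    by move/eqP; rewrite scaler_eq0 (negbTE uy) orbF => /eqP.
  by move: e; rewrite c0 scale0r add0r => /eqP; rewrite scaler_eq0 (negbTE uy) orbF => /eqP.
have basis (y' : T) : G 1%N y' -> act u y' = act u y ->
    Defs.basis_of (G 1%N) (fun i : 'I_2 => if i == ord0 then y' else act u y).
  move=> gy' uy'; case: rel0 => bv _ _ _ _; apply: basis_of_free2 bv _ _.
    by apply: ord2_ind => //=; apply: gact.
  move=> c; rewrite sum_ord2 /= => /(indep _ _ _ uy')[c0 c1].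
  by apply: ord2_ind.
have [al [be wy]] : exists al be : k, act w y = al *: y + be *: act u y.
  have [_ /(_ (act w y)) [/(_ (gact _ gy))[c ->] _]] := basis y gy erefl.
  by exists (c ord0), (c ord_max); rewrite sum_ord2.
pose y' := y - be *: act u y.
have uy' : act u y' = act u y.
  by rewrite /y' -scaleNr (actD hact) (actZ hact) uuy scaler0 addr0.
have gy' : G 1%N y'.
  by rewrite /y' -scaleNr addrC; apply: (gradeZD cg) => //; apply: gact.
have wuy : act w (act u y) = (al + 1) *: act u y.
  by rewrite wu wy (actD hact) !(actZ hact) uuy scaler0 addr0 scalerDl scale1r.
have wy' : act w y' = al *: y'.
  rewrite /y' -scaleNr (actD hact) (actZ hact) wuy wy scalerDr !scalerA -addrA -scalerDl.
  by congr (_ + _ *: _); ring.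
have y'0 : y' != 0.
  by apply: contraNneq uy => e; rewrite -uy' e (act0 hact).
have alp : al ^+ p = al.
  have it n : iter n (act w) y' = al ^+ n *: y'.
    elim: n => [|n IH]; first by rewrite scale1r.
    by rewrite /= IH (actZ hact) wy' scalerA -exprSr.
  have := it p; rewrite -(actX hact) wp wy' => /eqP.
  by rewrite -subr_eq0 -scalerBl scaler_eq0 (negbTE y'0) orbF subr_eq0 => /eqP.
have [i ip alE] := frobenius_fixed hp alp.
exists i, (fun j : 'I_2 => if j == ord0 then y' else act u y); split=> //; split.
- exact: basis.
- apply: ord2_ind => /=; first by rewrite addn0 -alE.
  by rewrite addn1 -natr1 -alE.
- apply: ord2_ind; apply: ord2_ind => //= _; exact: uy'.
- by apply: ord2_ind.
Qed.

Section StandardBasis.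
Variables (i : nat) (x : 'I_2 -> T).
Hypothesis sx : standard_basis u w act (G 1%N) i x.
Let x0 := x ord0.
Let x1 := x ord_max.

Let bx : Defs.basis_of (G 1%N) x. Proof. by case: sx. Qed.
Let gx j : G 1%N (x j).
Proof.
case: bx => _ h; apply/h; exists (fun l => (1%:M : 'M[k]_2) j l).
by symmetry; exact: mxact1.
Qed.
Let wx0 : act w x0 = i%:R *: x0. Proof. by case: sx => _ -> _ _; rewrite addn0. Qed.
Let wx1 : act w x1 = (i.+1)%:R *: x1. Proof. by case: sx => _ -> _ _; rewrite addn1. Qed.
Let ux0 : act u x0 = x1. Proof. by case: sx => _ _ h _; apply: h. Qed.
Let ux1 : act u x1 = 0. Proof. by case: sx => _ _ _; apply. Qed.

Let xfree (c d : k) : c *: x0 + d *: x1 = 0 -> c = 0 /\ d = 0.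
Proof.
move=> e; case: bx => /(_ (fun j => if j == ord0 then c else d)) h _.
rewrite sum_ord2 in h; have hh := h e; split; [exact: (hh ord0)|exact: (hh ord_max)].
Qed.
Let x1_neq0 : x1 != 0.
Proof.
apply/eqP => e; have [] := @xfree 0 1; first by rewrite e scale0r scaler0 addr0.
by move=> _ /eqP; rewrite oner_eq0.
Qed.

(** The relations  p0 x0^2 + q0 x1 x0 + p1 x0 x1 + q1 x1^2  form a line that is
   stable under  U.  The nilpotent  u  kills it, so  p0 = 0  and  p1 = - q0,
   with  q0 <> 0  by nondegeneracy.  Now  w  acts by  2i + 1  on the commutator
   and by  2i + 2  on  x1^2,  so  q1 = 0. *)
Lemma standard_relation : exists a, one_relator G x a /\ x0 * x1 = x1 * x0 /\
  forall s t, s * x0 + t * x1 = 0 -> exists z, s = z * x1.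
Proof.
have [pr prP] := graded_proj cg.
have [a rel] := one_relator_change_basis cg rel0 bx.
exists a; split=> //; have [_ [ga af] _ syz [ra _]] := rel.
have co j : exists c : k * k, a j = c.1 *: x0 + c.2 *: x1.
  by have [c ->] := (bx.2 _).1 (ga j); exists (c ord0, c ord_max); rewrite sum_ord2.
have [[p0 q0] /= a0E] := co ord0; have [[p1 q1] /= a1E] := co ord_max.
have anz : ~ (p0 = 0 /\ q0 = 0).
  move=> [e1 e2]; have := af (fun j => (j == ord0)%:R) _ ord0.
  rewrite sum_ord2 /= scale1r scale0r addr0 a0E e1 e2 !scale0r addr0.
  by move=> /(_ erefl)/eqP; rewrite oner_eq0.
have rE : (p0 *: x0 + q0 *: x1) * x0 + (p1 *: x0 + q1 *: x1) * x1 = 0.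
  by rewrite -a0E -a1E -[RHS]ra sum_ord2.
have unique (c0 d0 c1 d1 : k) : (c0 *: x0 + d0 *: x1) * x0 + (c1 *: x0 + d1 *: x1) * x1 = 0 ->
    exists s, [/\ c0 = s * p0, d0 = s * q0, c1 = s * p1 & d1 = s * q1].
  move=> e; pose t (j : 'I_2) := if j == ord0 then c0 *: x0 + d0 *: x1 else c1 *: x0 + d1 *: x1.
  have [|z zE] := syz t; first by rewrite sum_ord2.
  have gt j : G 1%N (t j).
    rewrite /t; case: ifP => _; apply: (gradeZD cg);
      by [exact: (gx _) | exact: (gradeZ cg _ (gx _))].
  have /(grade0E cg)[s sE] := projS prP 0%N z.
  have tE j : t j = s *: a j.
    have := projMr cg prP (ga j) 0%N z; rewrite -zE add0n (proj_id prP (gt j)) sE => ->.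
    by rewrite -scalerAl mul1r.
  have lin (c d c' d' : k) :
      c *: x0 + d *: x1 = s *: (c' *: x0 + d' *: x1) -> c = s * c' /\ d = s * d'.
    move=> h; have [] := @xfree (c - s * c') (d - s * d').
      rewrite !scalerBl -!scalerA addrACA h scalerDr -opprD subrr //.
    by move=> /eqP + /eqP; rewrite !subr_eq0 => /eqP -> /eqP ->.
  exists s.
  have [-> ->] := lin c0 d0 p0 q0 (etrans (tE ord0) (congr1 _ a0E)).
  by have [-> ->] := lin c1 d1 p1 q1 (etrans (tE ord_max) (congr1 _ a1E)).
have derE h : primitive h -> act h ((p0 *: x0 + q0 *: x1) * x0 + (p1 *: x0 + q1 *: x1) * x1) = 
    (p0 *: act h x0 + q0 *: act h x1) * x0 + (p0 *: x0 + q0 *: x1) * act h x0 +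
    ((p1 *: act h x0 + q1 *: act h x1) * x1 + (p1 *: x0 + q1 *: x1) * act h x1).
  by move=> ph; rewrite (actD hact) !(act_derivation hact ph) !(actD hact) !(actZ hact).
have [s [e1 e2 e3 e4]] : exists s, [/\ 0 = s * p0, p0 = s * q0, p0 = s * p1 & q0 + p1 = s * q1].
  apply: unique; have := derE u pu; rewrite rE (act0 hact) ux0 ux1 !scaler0 !addr0 mulr0 addr0 => e.
  by rewrite [RHS]e scale0r add0r scalerDl addrA [(_ + _ + _) * x1]mulrDl addrA.
have s0 : s = 0.
  apply/eqP; apply: contraT => snz; case: anz.
  have p00 : p0 = 0 by apply/eqP; move/esym/eqP: e1; rewrite mulf_eq0 (negbTE snz).
  by split=> //; apply/eqP; move/esym/eqP: e2; rewrite p00 mulf_eq0 (negbTE snz).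
have p00 : p0 = 0 by rewrite e2 s0 mul0r.
have q00 : q0 != 0 by apply/eqP => q00; case: anz.
have p1E : p1 = - q0 by apply/eqP; rewrite -addr_eq0 addrC e4 s0 mul0r.
have [t [_ f2 _ f4]] : exists t, [/\ 0 = t * p0, q0 * (2 * i%:R + 1) = t * q0,
    p1 * (2 * i%:R + 1) = t * p1 & q1 * (2 * i%:R + 2) = t * q1].
  apply: unique; have := derE w pw; rewrite rE (act0 hact) wx0 wx1 p00 !scale0r !add0r => e.
  rewrite [RHS]e !mulrDl -?scalerAr ?mulrDl -!scalerAl !scalerA.
  rewrite [X in _ = _ + X]addrACA -!scalerDl -natr1.
  by congr (_ *: _ + (_ *: _ + _ *: _)); ring.
have q10 : q1 = 0.
  have tE : t = 2 * i%:R + 1.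
    by apply: (mulIf q00); rewrite -f2 mulrC.
  apply/eqP; move/eqP: f4; rewrite tE -subr_eq0 => /eqP h; apply/eqP; rewrite -[RHS]h; ring.
have xc : x0 * x1 = x1 * x0.
  move: rE; rewrite p00 p1E q10 !scale0r add0r addr0 scaleNr mulNr -!scalerAl -scalerBr.
  by move/eqP; rewrite scaler_eq0 (negbTE q00) subr_eq0 => /eqP ->.
split=> // s' t' e.
have [|z zE] := syz (fun j => if j == ord0 then s' else t'); first by rewrite sum_ord2.
exists (q0 *: z); have /= -> := zE ord0; rewrite a0E p00 scale0r add0r.
by rewrite -scalerAl -scalerAr.
Qed.

(** ** Invariants *)
Section Monomials.
Hypothesis xC : x0 * x1 = x1 * x0.

Let comm_exp m n : x1 ^+ m * x0 ^+ n = x0 ^+ n * x1 ^+ m.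
Proof. by apply: commrX; apply/commr_sym/commrX. Qed.

Lemma act_u_x0X n : act u (x0 ^+ n) = n%:R *: (x0 ^+ n.-1 * x1).
Proof.
elim: n => [|n IH]; first by rewrite scale0r (act_primitive1 hact pu).
rewrite exprS (act_derivation hact pu) ux0 IH -scalerAr.
have := comm_exp 1 n; rewrite expr1 => ->.
case: n {IH} => [|n]; first by rewrite scale0r addr0 scale1r.
by rewrite mulrA -exprS -[in RHS]nat1r scalerDl scale1r.
Qed.

Lemma act_u_x1X n : act u (x1 ^+ n) = 0.
Proof.
elim: n => [|n IH]; first by rewrite (act_primitive1 hact pu).
by rewrite exprS (act_derivation hact pu) ux1 IH mul0r mulr0 addr0.
Qed.

Lemma act_u_monomial e : act u (monomial x e) = e.1%:R *: monomial x (e.1.-1, e.2.+1).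
Proof.
rewrite /monomial (act_derivation hact pu) act_u_x0X act_u_x1X mulr0 addr0 /=.
by rewrite -scalerAl -mulrA -exprS.
Qed.

Lemma act_w_exp y c n : act w y = c *: y -> act w (y ^+ n) = (n%:R * c) *: y ^+ n.
Proof.
move=> wy; elim: n => [|n IH]; first by rewrite mul0r scale0r (act_primitive1 hact pw).
rewrite exprS (act_derivation hact pw) wy IH -scalerAl -scalerAr -exprS -scalerDl.
by rewrite -nat1r mulrDl mul1r.
Qed.

Lemma act_w_monomial e : act w (monomial x e) = (e.1 * i + e.2 * i.+1)%:R *: monomial x e.
Proof.
rewrite /monomial (act_derivation hact pw) (act_w_exp _ wx0) (act_w_exp _ wx1).
by rewrite -scalerAl -scalerAr -scalerDl natrD !natrM.
Qed.

End Monomials.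

Lemma fixed_subalgebra : subalgebra (fixed act).
Proof.
split.
- split; first by apply/(fixedP hU hact); rewrite !(act0 hact).
  move=> c s t /(fixedP hU hact)[us ws] /(fixedP hU hact)[ut wt].
  by apply/(fixedP hU hact); rewrite !(actD hact) !(actZ hact) us ws ut wt scaler0 addr0.
- by apply/(fixedP hU hact); rewrite (act_primitive1 hact pu) (act_primitive1 hact pw).
- move=> s t /(fixedP hU hact)[us ws] /(fixedP hU hact)[ut wt].
  apply/(fixedP hU hact); rewrite (act_derivation hact pu) (act_derivation hact pw).
  by rewrite us ws ut wt !mulr0 !mul0r addr0.
Qed.

Lemma fixed_x0p : fixed act (x0 ^+ p).
Proof.
have [a [_ [xC _]]] := standard_relation.
apply/(fixedP hU hact); rewrite (act_u_x0X xC) (act_w_exp _ wx0) (pcharf0 hp).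
by rewrite mul0r !scale0r.
Qed.

Lemma fixed_x1X n : (p %| n * i.+1)%N -> fixed act (x1 ^+ n).
Proof.
move=> pn; apply/(fixedP hU hact); rewrite act_u_x1X (act_w_exp _ wx1); split=> //.
by rewrite -natrM; move: pn; rewrite (dvdn_pcharf hp) => /eqP ->; rewrite scale0r.
Qed.

(** u  sends  x0^a x1^b  to  a x0^(a-1) x1^(b+1)  and  w  scales it by
   a i + b (i + 1).  Distinct monomials with  a > 0  have distinct images under
   u,  so the coefficients can be compared one by one. *)
Lemma fixed_monomials t : fixed act t -> exists (s : seq (nat * nat)) (c : nat * nat -> k),
  t = \sum_(e <- s) c e *: monomial x e /\
  forall e, e \in s -> c e != 0 -> (p %| e.1)%N /\ (p %| e.2 * i.+1)%N.
Proof.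
move=> /(fixedP hU hact)[ut wt].
have [a [rel [xC syz]]] := standard_relation.
have mf := monomial_free cg rel syz.
have [s0 [c0 tE0]] := monomial_spanning cg rel xC t.
have [c _ tE] := spanning_uniq tE0.
have us := undup_uniq s0; set s := undup s0 in us tE.
exists s, c; split=> // e es ce.
have pe1 : (p %| e.1)%N.
  case: (posnP e.1) => [->|e1]; first exact: dvdn0.
  pose sh (e : nat * nat) := (e.1.-1, e.2.+1).
  pose c' (e : nat * nat) := c (e.1.+1, e.2.-1) * e.1.+1%:R.
  pose s1 := [seq e <- s | (0 < e.1)%N].
  have us1 : uniq [seq sh e | e <- s1].
    rewrite map_inj_in_uniq ?filter_uniq // => -[n1 n2] [m1 m2].
    rewrite !mem_filter => /andP[/= h1 _] /andP[/= h2 _] [].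
    by case: n1 h1 => // n1 _; case: m1 h2 => // m1 _ /= -> ->.
  have z : \sum_(e <- [seq sh e | e <- s1]) c' e *: monomial x e = 0.
    rewrite big_map big_filter -[RHS]ut tE (act_sum hact) [RHS](bigID (fun e => 0 < e.1)%N) /=.
    rewrite [X in _ = _ + X]big1 ?addr0 => [|[[|n1] n2] //= _]; last first.
      by rewrite (actZ hact) (act_u_monomial xC) scale0r scaler0.
    apply: eq_bigr => -[[|n1] n2] // _; rewrite (actZ hact) (act_u_monomial xC) scalerA.
    by rewrite /c' /sh /=.
  have := mf _ _ us1 z (sh e) (map_f _ _); rewrite mem_filter e1 es => /(_ isT)/eqP.
  by rewrite /c' /= prednK // -surjective_pairing mulf_eq0 (negbTE ce) -(dvdn_pcharf hp).
split=> //.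
have z : \sum_(e <- s) (c e * (e.1 * i + e.2 * i.+1)%:R) *: monomial x e = 0.
  rewrite -[RHS]wt tE (act_sum hact); apply: eq_bigr => e' _.
  by rewrite (actZ hact) act_w_monomial scalerA.
have /eqP := mf _ _ us z e es; rewrite mulf_eq0 (negbTE ce) -(dvdn_pcharf hp) /=.
by rewrite dvdn_addr // dvdn_mulr.
Qed.

(** The exponent  n  is  1  or  p,  according to whether  i + 1  vanishes
   in  k. *)
Lemma fixed_generated n : (p %| n * i.+1)%N ->
  (forall m, (p %| m * i.+1)%N -> (n %| m)%N) ->
  forall t, fixed act t <-> generated_by [:: x0 ^+ p; x1 ^+ n] t.
Proof.
move=> pn nmin t; split; last first.
  move=> /(_ _ fixed_subalgebra); apply=> y; rewrite !inE => /orP[] /eqP ->.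
    exact: fixed_x0p.
  exact: fixed_x1X.
move=> /fixed_monomials[s [c [-> sc]]] S subS Sg; have [[S0 SD] S1 SM] := subS.
have SX y m : S y -> S (y ^+ m).
  by move=> Sy; elim: m => [|m IH]; rewrite ?expr0 ?exprS //; apply: SM.
rewrite big_seq; apply: big_ind => // [y z sy sz|e es].
  by rewrite -[y]scale1r; apply: SD.
have [->|ce] := eqVneq (c e) 0; first by rewrite scale0r.
have [/dvdnP[m1 e1] /nmin/dvdnP[m2 e2]] := sc e es ce.
rewrite -[_ *: _]addr0; apply: SD => //; rewrite /monomial e1 e2.
by rewrite mulnC exprM mulnC exprM; apply: SM; apply: SX; apply: Sg; rewrite !inE eqxx ?orbT.
Qed.

(** Every nonzero submodule of  V  contains  x1. *)
Lemma standard_indecomposable : indecomposable act (G 1%N).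
Proof.
split; first exact: hhom.
  by exists x1; [exact: gx | exact: x1_neq0].
move=> A B [[A0 AD] Aact] [[B0 BD] Bact] AB disj.
have sub (S : T -> Prop) : subspace S -> (forall h y, S y -> S (act h y)) ->
    (forall y, S y -> G 1%N y) -> ~ (forall y, S y -> y = 0) -> S x1.
  move=> [S0 SD] Sact SG Snz.
  have SZ c y : S y -> S (c *: y) by move=> sy; rewrite -[_ *: _]addr0; apply: SD.
  have [h|h] := pselect (exists2 y, S y & y != 0); last first.
    case: Snz => y sy; apply/eqP; apply: contraT => y0; case: h; by exists y.
  have [y sy y0] := h.
  have [c yE] := (bx.2 y).1 (SG y sy); rewrite sum_ord2 in yE.
  have [c0|c0] := eqVneq (c ord0) 0.
    have c1 : c ord_max != 0.
      by apply: contraNneq y0 => c1; rewrite yE c0 c1 !scale0r addr0.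
    rewrite -[x1]scale1r -(mulVf c1) -scalerA; apply: SZ.
    by have := sy; rewrite yE c0 scale0r add0r.
  rewrite -[x1]scale1r -(mulVf c0) -scalerA; apply: SZ.
  have := Sact u y sy; rewrite yE (actD hact) !(actZ hact) -/x0 -/x1 ux0 ux1.
  by rewrite scaler0 addr0.
have [|nA] := pselect (forall y, A y -> y = 0); first by left.
have [|nB] := pselect (forall y, B y -> y = 0); first by right.
have Ax : A x1.
  by apply: sub => // y Ay; apply/AB; exists y, 0; rewrite addr0.
have Bx : B x1.
  by apply: sub => // y By; apply/AB; exists 0, y; rewrite add0r.
by have := x1_neq0; rewrite (disj _ Ax Bx) eqxx.
Qed.

End StandardBasis.
End Quotients.

Theorem proposition3p2 (k : fieldType) (p : nat) (hp : p \in [pchar k])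
    (U : hopfAlgebra k) (u w : U) (hU : is_U p u w)
    (T : algType k) (G : nat -> T -> Prop)
    (hreg : AS_regular G 2) (hnoeth : noetherian T) (hkoszul : koszul G)
    (act : U -> T -> T) (hact : hopf_action act)
    (hfaithful : inner_faithful act) (hhom : homogeneous_action act G) :
  [/\ (forall a b : T, a * b = b * a) /\ polynomial_ring_on (G 1%N),
      has_dim (G 1%N) 2 /\ indecomposable act (G 1%N),
      exists (i : nat) (x : 'I_2 -> T),
        (i <= p.-1)%N /\ standard_basis u w act (G 1%N) i x
    & forall (i : nat) (x : 'I_2 -> T), (i <= p.-1)%N ->
        standard_basis u w act (G 1%N) i x ->
        (i = p.-1 -> forall a, fixed act a <->
           generated_by [:: x ord0 ^+ p; x ord_max] a) /\
        ((i <= p - 2)%N -> forall a, fixed act a <->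
           generated_by [:: x ord0 ^+ p; x ord_max ^+ p] a)].
Proof.
have pp := pcharf_prime hp; have p1 := prime_gt1 pp.
case: hreg => cg [[gl _] _] [l [AS _]] GK.
have [n [v [a rel]]] := koszul_AS_one_relator cg gl hkoszul AS.
have [pr prP] := graded_proj cg.
have n2 := relation_rank_eq2 cg prP rel GK; subst n.
have [i [x [ip sx]]] := exists_standard_basis hp hU cg hact hhom rel hfaithful.
have [a' [rel' [xC syz]]] := standard_relation hU cg hact rel sx.
split.
- split; first by move=> s t; apply: (plane_comm cg rel' xC).
  exact: (plane_polynomial_ring cg rel' xC syz).
- split; last exact: (standard_indecomposable hact hhom sx).
  by exists x; case: sx.
- by exists i, x.
move=> {i x ip sx a' rel' xC syz} i x ip sx; split=> [ie|ile].
  rewrite -[x ord_max]expr1; apply: (fixed_generated hp hU cg hact rel sx) => [|m _].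
    by rewrite mul1n ie prednK // ltnW.
  exact: dvd1n.
apply: (fixed_generated hp hU cg hact rel sx) => [|m].
  exact: dvdn_mulr.
rewrite Euclid_dvdM // => /orP[//|]; rewrite gtnNdvd //; lia.
Qed.
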